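(* Let $R=\mathbb{Q}[x_1,\dots,x_k]$ and $R_y=R[y]/\langle y^l+\alpha_1y^{l-1}+\alpha_2y^{l-2}+\cdots+\alpha_l\rangle$ with $\alpha_i\in R$ (graded, variables of positive degree, all polynomials homogeneous). (1) Let $a_i\in R_y$ ($i=1,\dots,m$), $b_i\in R$ ($i=2,\dots,m$), and let $b_1,\beta\in R_y$ be such that $(y+\beta)b_1\in R$. Suppose that (i) $(y+\beta)b_1,b_2,\dots,b_m$ form a regular sequence in $R$, and (ii) $\omega:=a_1b_1(y+\beta)+\sum_{i=2}^m a_ib_i\in R$. Then there are polynomials $a_i'\in R$ ($i=1,\dots,m$) and an isomorphism in $\mathrm{MF}^{gr}_{R,\omega}$ $$K\left(\begin{pmatrix} (y+\beta)a_1 \\ {a_2} \\ \vdots \\ {a_m} \end{pmatrix};\begin{pmatrix} {b_1} \\ {b_2} \\ \vdots \\ {b_m} \end{pmatrix}\right)_{R_y}\simeq K\left(\begin{pmatrix} (y+\beta)a_1' \\ {a_2'} \\ \vdots \\ {a_m'} \end{pmatrix};\begin{pmatrix} {b_1} \\ {b_2} \\ \vdots \\ {b_m} \end{pmatrix}\right)_{R_y}.$$ (2) Let $a_i\in R_y$ ($i=1,\dots,m$), $b_i\in R$ ($i=1,\dots,m$) and $\beta\in R$. Suppose that (i) $b_1,b_2,\dots,b_m$ form a regular sequence in $R$, and (ii) $\omega':=a_1b_1(y+\beta)+\sum_{i=2}^m a_ib_i\in R$. Then there are polynomials $a_1'\in R_y$ and $a_i'\in R$ ($i=2,\dots,m$)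 and an isomorphism in $\mathrm{MF}^{gr}_{R,\omega'}$ $$K\left(\begin{pmatrix} {a_1} \\ {a_2} \\ \vdots \\ {a_m} \end{pmatrix};\begin{pmatrix} b_1(y+\beta) \\ {b_2} \\ \vdots \\ {b_m} \end{pmatrix}\right)_{R_y}\simeq K\left(\begin{pmatrix} {a_1'} \\ {a_2'} \\ \vdots \\ {a_m'} \end{pmatrix};\begin{pmatrix} b_1(y+\beta) \\ {b_2} \\ \vdots \\ {b_m} \end{pmatrix}\right)_{R_y}.$$
   Context: For a $\mathbb{Z}$-graded module $M$ and $n\in\mathbb{Z}$, $M\{n\}$ is $M$ with the grading shifted up by $n$: the degree $i+n$ part of $M\{n\}$ is $M^i$. Let $R$ be a $\mathbb{Z}$-graded polynomial ring over $\mathbb{Q}$ and $\omega\in R$ homogeneous. A matrix factorization with potential $\omega$ is $\overline M=(M_0,M_1,d_{M_0},d_{M_1})$ with $M_0,M_1$ free $\mathbb{Z}$-graded $R$-modules (infinite rank allowed) and $R$-linear maps $d_{M_0}:M_0\to M_1$, $d_{M_1}:M_1\to M_0$ with $d_{M_1}d_{M_0}=\omega\,\mathrm{Id}$, $d_{M_0}d_{M_1}=\omega\,\mathrm{Id}$. $\mathrm{MF}^{gr}_{R,\omega}$ is the category of these; a morphism $\overline M\to\overline N$ is a pair of grading-preserving $R$-linear maps $f_0:M_0\to N_0$, $f_1:M_1\to N_1$ commuting with the differentials (isomorphisms here are honest isomorphisms, not up to homotopy). The tensor product of matrix factorizations is $$\overline M\boxtimes\overline N=\left(\begin{matrix}M_0\otimes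 N_0\\ \oplus\\ M_1\otimes N_1\end{matrix},\ \begin{matrix}M_1\otimes N_0\\ \oplus\\ M_0\otimes N_1\end{matrix},\ \begin{pmatrix}d_{M_0}&-d_{N_1}\\ d_{N_0}&d_{M_1}\end{pmatrix},\ \begin{pmatrix}d_{M_1}&d_{N_1}\\ -d_{N_0}&d_{M_0}\end{pmatrix}\right).$$ Koszul matrix factorization: for homogeneous $a,b\in R_y$, $K(a;b)_{R_y}=(R_y,\,R_y\{\tfrac12(\deg b-\deg a)\},\,a,\,b)$, and for sequences $K(\mathbf{a};\mathbf{b})_{R_y}=\boxtimes_{i}K(a_i;b_i)_{R_y}$ (tensor over $R_y$), with potential $\sum a_ib_i$; the sums $\deg a_i+\deg b_i$ of the degrees of paired entries are all equal to the degree of the potential. Since the potential lies in $R$ and $R_y$ is free over $R$, these are regarded as matrix factorizations over $R$. ''Polynomials in $R_y$'' means elements of $R_y$; $y$ has a positive degree for which the defining relation of $R_y$ is homogeneous. *)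

(* Defs.v *)
From HB Require Import structures.
From mathcomp Require Import all_boot all_order all_algebra.
From mathcomp Require Import boolp.
From mathcomp Require Import mpoly.

Set Implicit Arguments.
Unset Strict Implicit.
Unset Printing Implicit Defensive.

Import GRing.Theory.
Local Open Scope ring_scope.
Local Open Scope quotient_scope.

(* An element of the tensor product is represented by a sequence of pairs, a  *)
(* formal sum of pure tensors; two formal sums are identified when every      *)
(* bilinear map to every module gives them the same value.  The universal     *)
(* property is tensor_liftE and tensor_lift_uniq.                             *)

Section Tensor.
Context (S : comNzRingType) (M N : lmodType S).

Definition tensor_sum (V : lmodType S) (f : M -> N -> V) (s : seq (M * N)) : V :=
  \sum_(p <- s) f p.1 p.2.

Definition tensor_rel : rel (seq (M * N)) := fun s t =>
  `[< forall (V : lmodType S) (f : {bilinear M -> N -> V}),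
        tensor_sum f s = tensor_sum f t >].

Fact tensor_rel_refl : reflexive tensor_rel.
Proof. by move=> s; apply/asboolP. Qed.

Fact tensor_rel_sym : ssrbool.symmetric tensor_rel.
Proof. by move=> s t; apply/asboolP/asboolP => H V f; rewrite H. Qed.

Fact tensor_rel_trans : transitive tensor_rel.
Proof.
move=> t s u /asboolP st /asboolP tu; apply/asboolP => V f.
by rewrite st tu.
Qed.

Canonical tensor_equiv :=
  EquivRel tensor_rel tensor_rel_refl tensor_rel_sym tensor_rel_trans.

Definition tensor : Type := {eq_quot tensor_rel}.
HB.instance Definition _ := Choice.on tensor.

Definition tensor_of (s : seq (M * N)) : tensor := \pi_{eq_quot tensor_rel} s.
Definition tensor_repr (x : tensor) : seq (M * N) :=
  @repr _ {eq_quot tensor_rel} x.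

Definition tensor_lift (V : lmodType S) (f : {bilinear M -> N -> V})
    (x : tensor) : V :=
  tensor_sum f (tensor_repr x).

Lemma tensor_reprK x : tensor_of (tensor_repr x) = x.
Proof. exact: reprK. Qed.

Lemma tensor_lift_of (V : lmodType S) (f : {bilinear M -> N -> V}) s :
  tensor_lift f (tensor_of s) = tensor_sum f s.
Proof.
have /eqmodP/asboolP/(_ V f) // :
  tensor_repr (tensor_of s) = s %[mod {eq_quot tensor_rel}].
exact: (tensor_reprK (tensor_of s)).
Qed.

Lemma tensor_ext (x y : tensor) :
  (forall (V : lmodType S) (f : {bilinear M -> N -> V}),
     tensor_lift f x = tensor_lift f y) -> x = y.
Proof.
move=> H; rewrite -(tensor_reprK x) -(tensor_reprK y).
by apply/eqmodP/asboolP => V f; apply: H.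
Qed.

Definition tensor_zero : tensor := tensor_of [::].
Definition tensor_add (x y : tensor) : tensor :=
  tensor_of (tensor_repr x ++ tensor_repr y).
Definition tensor_scale (a : S) (x : tensor) : tensor :=
  tensor_of [seq (a *: p.1, p.2) | p <- tensor_repr x].
Definition tensor_opp (x : tensor) : tensor := tensor_scale (-1) x.

Section LiftOps.
Context (V : lmodType S) (f : {bilinear M -> N -> V}).

Fact tensor_lift0 : tensor_lift f tensor_zero = 0.
Proof. by rewrite tensor_lift_of /tensor_sum big_nil. Qed.

Fact tensor_liftD x y :
  tensor_lift f (tensor_add x y) = tensor_lift f x + tensor_lift f y.
Proof. by rewrite tensor_lift_of /tensor_sum big_cat. Qed.

Fact tensor_liftZ a x :
  tensor_lift f (tensor_scale a x) = a *: tensor_lift f x.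
Proof.
rewrite tensor_lift_of /tensor_sum big_map scaler_sumr.
by apply: eq_bigr => p _ /=; rewrite linearZl_LR.
Qed.

Fact tensor_liftN x : tensor_lift f (tensor_opp x) = - tensor_lift f x.
Proof. by rewrite tensor_liftZ scaleN1r. Qed.

End LiftOps.

Let liftE := (tensor_lift0, tensor_liftD, tensor_liftN, tensor_liftZ).

Fact tensor_addA : associative tensor_add.
Proof. by move=> x y z; apply: tensor_ext => V f; rewrite !liftE addrA. Qed.
Fact tensor_addC : commutative tensor_add.
Proof. by move=> x y; apply: tensor_ext => V f; rewrite !liftE addrC. Qed.
Fact tensor_add0 : left_id tensor_zero tensor_add.
Proof. by move=> x; apply: tensor_ext => V f; rewrite !liftE add0r. Qed.
Fact tensor_addN : left_inverse tensor_zero tensor_opp tensor_add.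
Proof. by move=> x; apply: tensor_ext => V f; rewrite !liftE addNr. Qed.

HB.instance Definition _ := GRing.isZmodule.Build tensor
  tensor_addA tensor_addC tensor_add0 tensor_addN.

Fact tensor_scaleA a b x :
  tensor_scale a (tensor_scale b x) = tensor_scale (a * b) x.
Proof. by apply: tensor_ext => V f; rewrite !liftE scalerA. Qed.
Fact tensor_scale1 : left_id 1 tensor_scale.
Proof. by move=> x; apply: tensor_ext => V f; rewrite !liftE scale1r. Qed.
Fact tensor_scaleDr : right_distributive tensor_scale +%R.
Proof. by move=> a x y; apply: tensor_ext => V f; rewrite !liftE scalerDr. Qed.
Fact tensor_scaleDl x : {morph tensor_scale^~ x : a b / a + b}.
Proof. by move=> a b; apply: tensor_ext => V f; rewrite !liftE scalerDl. Qed.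

HB.instance Definition _ := GRing.Zmodule_isLmodule.Build S tensor
  tensor_scaleA tensor_scale1 tensor_scaleDr tensor_scaleDl.

Fact tensor_lift_is_linear (V : lmodType S) (f : {bilinear M -> N -> V}) :
  linear (tensor_lift f).
Proof. by move=> a x y; rewrite liftE; congr (_ + _); apply: tensor_liftZ. Qed.

HB.instance Definition _ (V : lmodType S) (f : {bilinear M -> N -> V}) :=
  GRing.isLinear.Build S tensor V _ (tensor_lift f) (tensor_lift_is_linear f).

Definition tensor_pure (x : M) (y : N) : tensor := tensor_of [:: (x, y)].

Lemma tensor_liftE (V : lmodType S) (f : {bilinear M -> N -> V}) x y :
  tensor_lift f (tensor_pure x y) = f x y.
Proof. by rewrite tensor_lift_of /tensor_sum big_seq1. Qed.

Fact tensor_pure_is_bilinear : bilinear_for *:%R *:%R tensor_pure.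
Proof.
split=> [y a x x' | x a y y']; apply: tensor_ext => V f;
  by rewrite linearP /= !tensor_liftE (linearPl, linearPr).
Qed.

HB.instance Definition _ := bilinear_isBilinear.Build S M N tensor _ _
  tensor_pure tensor_pure_is_bilinear.

Lemma tensor_sum_pure x :
  x = \sum_(p <- tensor_repr x) tensor_pure p.1 p.2.
Proof.
apply: tensor_ext => V f; rewrite linear_sum /=.
by apply: eq_bigr => p _; rewrite tensor_liftE.
Qed.

Lemma tensor_lift_uniq (V : lmodType S) (g h : {linear tensor -> V}) :
  (forall x y, g (tensor_pure x y) = h (tensor_pure x y)) -> g =1 h.
Proof.
move=> gh x; rewrite (tensor_sum_pure x) !linear_sum.
by apply: eq_bigr => p _; apply: gh.
Qed.

End Tensor.

Section TensorMap.
Context (S : comNzRingType) (M N M' N' : lmodType S).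
Context (f : {linear M -> M'}) (g : {linear N -> N'}).

Definition tensor_map_pure (x : M) (y : N) : tensor M' N' :=
  tensor_pure (f x) (g y).

Fact tensor_map_pure_is_bilinear : bilinear_for *:%R *:%R tensor_map_pure.
Proof.
by split=> [y a x x' | x a y y']; rewrite /tensor_map_pure linearP
  (linearPl, linearPr).
Qed.

HB.instance Definition _ := bilinear_isBilinear.Build S M N (tensor M' N') _ _
  tensor_map_pure tensor_map_pure_is_bilinear.

Definition tensor_map : tensor M N -> tensor M' N' :=
  tensor_lift tensor_map_pure.
HB.instance Definition _ := GRing.Linear.on tensor_map.

Lemma tensor_mapE x y : tensor_map (tensor_pure x y) = tensor_pure (f x) (g y).
Proof. exact: tensor_liftE. Qed.

End TensorMap.

Section RestrictScalars.
Context (R S : comNzRingType) (h : {rmorphism R -> S}).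

Definition restr (M : lmodType S) : Type := M.

Section Instances.
Context (M : lmodType S).
HB.instance Definition _ := GRing.Zmodule.on (restr M).

Definition restr_scale (r : R) (x : restr M) : restr M := h r *: (x : M).

Fact restr_scaleA a b x : restr_scale a (restr_scale b x) = restr_scale (a * b) x.
Proof. by rewrite /restr_scale scalerA rmorphM. Qed.
Fact restr_scale1 : left_id 1 restr_scale.
Proof. by move=> x; rewrite /restr_scale rmorph1 scale1r. Qed.
Fact restr_scaleDr : right_distributive restr_scale +%R.
Proof. by move=> a x y; rewrite /restr_scale scalerDr. Qed.
Fact restr_scaleDl x : {morph restr_scale^~ x : a b / a + b}.
Proof. by move=> a b; rewrite /restr_scale rmorphD scalerDl. Qed.

HB.instance Definition _ := GRing.Zmodule_isLmodule.Build R (restr M)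
  restr_scaleA restr_scale1 restr_scaleDr restr_scaleDl.
End Instances.

Definition restr_lmod (M : lmodType S) : lmodType R := restr M.

Section Map.
Context (M N : lmodType S) (f : {linear M -> N}).

Definition restr_fun : restr M -> restr N := f.

Fact restr_fun_is_linear : linear (restr_fun : restr_lmod M -> restr_lmod N).
Proof. by move=> a x y; apply: (linearP f). Qed.

HB.instance Definition _ := GRing.isLinear.Build R (restr_lmod M) (restr_lmod N)
  _ restr_fun restr_fun_is_linear.

Definition restr_map : {linear restr_lmod M -> restr_lmod N} := restr_fun.
End Map.

End RestrictScalars.

(* hom d x reads: x is homogeneous of degree d; so 0 has every degree.        *)

Definition is_grading (V : zmodType) (hom : int -> V -> Prop) : Prop :=
  [/\ forall d, hom d 0,
      forall d x y, hom d x -> hom d y -> hom d (x - y),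
      forall x, exists (s : seq int) (c : int -> V),
        (forall d, hom d (c d)) /\ x = \sum_(d <- s) c d
    & forall (s : seq int) (c : int -> V), uniq s ->
        (forall d, hom d (c d)) -> \sum_(d <- s) c d = 0 ->
        forall d, d \in s -> c d = 0].

(* The axioms of a graded module are stated by is_graded_module.              *)
Record gmod (S : comNzRingType) := GMod {
  gmod_sort :> lmodType S;
  ghom : int -> gmod_sort -> Prop
}.
Arguments ghom {S} _ _ _.

Section GradedModules.
Context (S : comNzRingType) (homS : int -> S -> Prop).

Definition is_graded_module (M : gmod S) : Prop :=
  is_grading (ghom M) /\
  forall i j (a : S) (x : M), homS i a -> ghom M j x -> ghom M (i + j) (a *: x).

Definition is_basis (M : lmodType S) (I : choiceType) (e : I -> M) : Prop :=
  (forall x, exists (s : seq I) (c : I -> S), x = \sum_(i <- s) c i *: e i) /\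
  (forall (s : seq I) (c : I -> S), uniq s ->
     \sum_(i <- s) c i *: e i = 0 -> forall i, i \in s -> c i = 0).

Definition is_free_graded (M : gmod S) : Prop :=
  is_graded_module M /\
  exists (I : choiceType) (e : I -> M),
    is_basis e /\ forall i, exists d, ghom M d (e i).

Definition reg_gmod : gmod S := GMod (homS : int -> S^o -> Prop).

Definition shift_gmod (n : int) (M : gmod S) : gmod S :=
  GMod (fun d (x : M) => ghom M (d - n) x).

Definition sum_gmod (M N : gmod S) : gmod S :=
  GMod (fun d (x : (M * N)%type) => ghom M d x.1 /\ ghom N d x.2).

Definition tensor_gmod (M N : gmod S) : gmod S :=
  GMod (fun d (x : tensor M N) => exists s : seq (M * N),
    (forall p, p \in s ->
       exists i j : int, [/\ i + j = d, ghom M i p.1 & ghom N j p.2]) /\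
    x = \sum_(p <- s) tensor_pure p.1 p.2).

End GradedModules.

Definition restr_gmod (R S : comNzRingType) (h : {rmorphism R -> S})
    (M : gmod S) : gmod R :=
  @GMod R (restr_lmod h M) (ghom M).

(* The objects of MF^gr_{S,w} are the mf_data satisfying is_mf homS w.        *)

Record mf_data (S : comNzRingType) := MFData {
  mf0 : gmod S;
  mf1 : gmod S;
  mfd0 : {linear mf0 -> mf1};
  mfd1 : {linear mf1 -> mf0}
}.

Section MatrixFactorizations.
Context (S : comNzRingType) (homS : int -> S -> Prop).

Definition is_mf (w : S) (M : mf_data S) : Prop :=
  [/\ exists d, homS d w,
      is_free_graded homS (mf0 M),
      is_free_graded homS (mf1 M),
      forall x, mfd1 M (mfd0 M x) = w *: x
    & forall x, mfd0 M (mfd1 M x) = w *: x].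

Definition is_mf_morphism (M N : mf_data S)
    (f0 : {linear mf0 M -> mf0 N}) (f1 : {linear mf1 M -> mf1 N}) : Prop :=
  [/\ forall d x, ghom (mf0 M) d x -> ghom (mf0 N) d (f0 x),
      forall d x, ghom (mf1 M) d x -> ghom (mf1 N) d (f1 x),
      forall x, f1 (mfd0 M x) = mfd0 N (f0 x)
    & forall x, f0 (mfd1 M x) = mfd1 N (f1 x)].

Definition mf_isomorphic (w : S) (M N : mf_data S) : Prop :=
  [/\ is_mf w M, is_mf w N &
    exists (f0 : {linear mf0 M -> mf0 N}) (f1 : {linear mf1 M -> mf1 N})
           (g0 : {linear mf0 N -> mf0 M}) (g1 : {linear mf1 N -> mf1 M}),
      [/\ is_mf_morphism f0 f1, is_mf_morphism g0 g1,
          cancel f0 g0 /\ cancel g0 f0 & cancel f1 g1 /\ cancel g1 f1]].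

Section MFTensor.
Context (M N : mf_data S).
Local Notation M0 := (mf0 M).
Local Notation M1 := (mf1 M).
Local Notation N0 := (mf0 N).
Local Notation N1 := (mf1 N).
Local Notation T0 := (sum_gmod (tensor_gmod M0 N0) (tensor_gmod M1 N1)).
Local Notation T1 := (sum_gmod (tensor_gmod M1 N0) (tensor_gmod M0 N1)).
Local Notation "f ⊗ g" := (tensor_map f g) (at level 40).
Local Notation id := (idfun : {linear _ -> _}).

Definition mf_tensor_fun0 (x : T0) : T1 :=
  ((mfd0 M ⊗ id) x.1 - (id ⊗ mfd1 N) x.2,
   (id ⊗ mfd0 N) x.1 + (mfd1 M ⊗ id) x.2).

Definition mf_tensor_fun1 (x : T1) : T0 :=
  ((mfd1 M ⊗ id) x.1 + (id ⊗ mfd1 N) x.2,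
   - (id ⊗ mfd0 N) x.1 + (mfd0 M ⊗ id) x.2).

Fact mf_tensor_fun0_is_linear : linear mf_tensor_fun0.
Proof.
move=> a x y; congr (_, _); rewrite /= !linearP /=.
  by rewrite scalerDr addrACA.
by rewrite scalerDr addrACA.
Qed.

Fact mf_tensor_fun1_is_linear : linear mf_tensor_fun1.
Proof.
move=> a x y; congr (_, _); rewrite /= !linearP /=.
  by rewrite scalerDr addrACA.
by rewrite scaleN1r -scalerN addrACA.
Qed.

HB.instance Definition _ :=
  GRing.isLinear.Build S T0 T1 _ mf_tensor_fun0 mf_tensor_fun0_is_linear.
HB.instance Definition _ :=
  GRing.isLinear.Build S T1 T0 _ mf_tensor_fun1 mf_tensor_fun1_is_linear.

Definition mf_tensor : mf_data S :=
  @MFData S T0 T1 mf_tensor_fun0 mf_tensor_fun1.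

End MFTensor.

(* One row of a Koszul matrix factorization with the degrees of its entries,  *)
(* which the entries do not determine when they are 0.                        *)
Record koszul_row := KRow {
  krow_dega : int;
  krow_degb : int;
  krow_a : S;
  krow_b : S
}.

(* The quotient by 2 is only meaningful when deg b - deg a is even.           *)
Definition koszul1 (r : koszul_row) : mf_data S :=
  @MFData S (reg_gmod homS)
    (shift_gmod ((krow_degb r - krow_dega r) %/ 2)%Z (reg_gmod homS))
    (krow_a r \*: idfun : {linear S^o -> S^o})
    (krow_b r \*: idfun : {linear S^o -> S^o}).

Definition koszul (r : koszul_row) (rs : seq koszul_row) : mf_data S :=
  foldl (fun M r' => mf_tensor M (koszul1 r')) (koszul1 r) rs.

End MatrixFactorizations.

Definition restr_mf (R S : comNzRingType) (h : {rmorphism R -> S})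
    (M : mf_data S) : mf_data R :=
  @MFData R (restr_gmod h (mf0 M)) (restr_gmod h (mf1 M))
    (restr_map h (mfd0 M)) (restr_map h (mfd1 M)).

Definition in_ideal (R : comNzRingType) (s : seq R) (x : R) : Prop :=
  exists c : nat -> R, x = \sum_(i < size s) c i * s`_i.

Definition regular_seq (R : comNzRingType) (s : seq R) : Prop :=
  (forall i x, (i < size s)%N ->
     in_ideal (take i s) (s`_i * x) -> in_ideal (take i s) x) /\
  ~ in_ideal s 1.

(* Weighted degree of a monomial, the variable x_i having degree wt i.        *)
Definition wdeg (k : nat) (wt : 'I_k -> nat) (m : 'X_{1..k}) : nat :=
  (\sum_(i < k) m i * wt i)%N.

Fact wdeg0 k (wt : 'I_k -> nat) : wdeg wt 0%MM = 0%N.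
Proof. by rewrite /wdeg big1 // => i _; rewrite mnm0E. Qed.

Fact wdegD k (wt : 'I_k -> nat) :
  {morph wdeg wt : m1 m2 / (m1 + m2)%MM >-> (m1 + m2)%N}.
Proof.
move=> m1 m2; rewrite /wdeg -big_split /=.
by apply: eq_bigr => i _; rewrite mnmDE mulnDl.
Qed.

HB.instance Definition _ k (wt : 'I_k -> nat) :=
  isMeasure.Build k (wdeg wt) (wdeg0 wt) (wdegD wt).

Definition homR (k : nat) (wt : 'I_k -> nat) (d : int) (p : {mpoly rat[k]}) :
    Prop :=
  match d with
  | Posz n => p \is n.-homog for (wdeg wt)
  | Negz _ => p = 0
  end.

(* Homogeneous elements of R[y], where y has degree dy.                       *)
Definition homRX (k : nat) (wt : 'I_k -> nat) (dy : nat) (d : int)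
    (P : {poly {mpoly rat[k]}}) : Prop :=
  forall j : nat, homR wt (d - (j * dy)%:Z) P`_j.

Section Ry.
Context (k l : nat) (alpha : 'I_l -> {mpoly rat[k]}).

(* alpha i is the coefficient alpha_(i+1) of y^(l-(i+1)).                     *)
Definition yrel : {poly {mpoly rat[k]}} :=
  'X^l + \sum_(i < l) (alpha i)%:P * 'X^(l - i.+1).

Definition Ry : comNzRingType := {poly %/ yrel}.
Definition yvar : Ry := 'qX.
Definition RtoRy : {rmorphism {mpoly rat[k]} -> Ry} := qpolyC yrel.

(* The grading of the quotient: images of homogeneous elements of R[y].       *)
Definition homRy (wt : 'I_k -> nat) (dy : nat) (d : int) (x : Ry) : Prop :=
  exists2 P, homRX wt dy d P & x = in_qpoly yrel P.

End Ry.

(* Main.v *)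
Require Import Defs.
From HB Require Import structures.
From mathcomp Require Import all_boot all_order all_algebra.
From mathcomp Require Import mpoly.
From mathcomp Require Import ring zify.

(* A syzygy of a regular sequence b is of the form T b with T antisymmetric,   *)
(* and K(a; b) is isomorphic to K(a + T b; b) for every antisymmetric T: the   *)
(* last column t of T is realised by conjugation with 1 + e h, where e is the  *)
(* exterior generator of the last row and h = sum_i t_i e_i.  It therefore     *)
(* suffices to find new entries whose difference from the old ones is, up to   *)
(* the factor y + beta, a syzygy over R_y.  As R_y is free over R, syzygies    *)
(* over R_y of elements of R are computed coefficientwise in y.  In (1) a_i'   *)
(* is the constant coefficient of a_i.  In (2) a_i' is the remainder of a_i by *)
(* y + beta, and a_1' is a constant times the quotient of the defining         *)
(* polynomial of R_y by y + beta.                                              *)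

Set Implicit Arguments.
Unset Strict Implicit.
Unset Printing Implicit Defensive.

Import GRing.Theory.
Local Open Scope ring_scope.

(* [mpoly] has a lemma named [mf0] as well. *)
Local Notation mf0 := Defs.mf0.

(** * Koszul matrix factorizations without tensor products *)

(** On the exterior algebra with one odd generator e_i per row, the differential d of K(a; b) is, up
    to signs, exterior multiplication by sum_i a_i e_i plus contraction with b. It is linear in (a,
    b) and squares to sum_i a_i b_i ([kdiffK]). If h is multiplication by sum_i t_i e_i, then h^2 =
    0 and dh + hd = sum_i t_i b_i. These two identities drive [kmodel_shear], and induction on the
    rows gives [kmodel_antisym]: a may be changed by T b for every antisymmetric T of the right
    degrees. [koszul_kmodel] identifies this model with the iterated tensor product, and
    [is_mf_restr] supplies freeness and the potential over R.

    It remains to find T; put z = y + beta. In (1), w = a_1 c_1 + sum a_i b_i with c_1 = z b_1 in R.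
    Taking constant coefficients in y leaves w unchanged, so the differences between the constant
    coefficients and the a_i form a syzygy of the regular sequence (c_1, b_2, ...), which
    [quotient_syzygy] writes as T (c_1, b_2, ...). In (2), write a_i = r_i + z q_i; [split_syzygy]
    finds a_1' such that (a_1' - a_1, -q_i) is a syzygy of (b_1, b_2, ...). In both cases some
    entries of T are then multiplied by z, to account for the position of z in the first row. *)

Section MFIso.
Context (S : comNzRingType).

Definition mf_iso (M N : mf_data S) : Prop :=
  exists (f0 : {linear mf0 M -> mf0 N}) (f1 : {linear mf1 M -> mf1 N})
         (g0 : {linear mf0 N -> mf0 M}) (g1 : {linear mf1 N -> mf1 M}),
    [/\ is_mf_morphism f0 f1, is_mf_morphism g0 g1,
        cancel f0 g0 /\ cancel g0 f0 & cancel f1 g1 /\ cancel g1 f1].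

(** The inverses inherit linearity and compatibility with the differentials from [f0] and [f1];
    compatibility with the grading is not inherited and is asked in both directions. *)
Lemma mf_isoI (M N : mf_data S)
    (f0 : mf0 M -> mf0 N) (f1 : mf1 M -> mf1 N)
    (g0 : mf0 N -> mf0 M) (g1 : mf1 N -> mf1 M) :
  linear f0 -> linear f1 ->
  cancel f0 g0 -> cancel g0 f0 -> cancel f1 g1 -> cancel g1 f1 ->
  (forall d x, ghom (mf0 M) d x -> ghom (mf0 N) d (f0 x)) ->
  (forall d x, ghom (mf1 M) d x -> ghom (mf1 N) d (f1 x)) ->
  (forall d x, ghom (mf0 N) d x -> ghom (mf0 M) d (g0 x)) ->
  (forall d x, ghom (mf1 N) d x -> ghom (mf1 M) d (g1 x)) ->
  (forall x, f1 (mfd0 M x) = mfd0 N (f0 x)) ->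
  (forall x, f0 (mfd1 M x) = mfd1 N (f1 x)) ->
  mf_iso M N.
Proof.
move=> lf0 lf1 fK0 gK0 fK1 gK1 hf0 hf1 hg0 hg1 c0 c1.
have lg0 : linear g0.
  by move=> a x y; apply: (can_inj fK0); rewrite lf0 !gK0.
have lg1 : linear g1.
  by move=> a x y; apply: (can_inj fK1); rewrite lf1 !gK1.
pose F0 : {linear _ -> _} := HB.pack f0 (GRing.isLinear.Build _ _ _ _ f0 lf0).
pose F1 : {linear _ -> _} := HB.pack f1 (GRing.isLinear.Build _ _ _ _ f1 lf1).
pose G0 : {linear _ -> _} := HB.pack g0 (GRing.isLinear.Build _ _ _ _ g0 lg0).
pose G1 : {linear _ -> _} := HB.pack g1 (GRing.isLinear.Build _ _ _ _ g1 lg1).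
exists F0, F1, G0, G1; split=> //; split=> //= x.
  by apply: (can_inj fK1); rewrite c0 gK0 gK1.
by apply: (can_inj fK0); rewrite c1 gK0 gK1.
Qed.

Lemma mf_iso_sym M N : mf_iso M N -> mf_iso N M.
Proof. by case=> [f0 [f1 [g0 [g1 [? ? [? ?] [? ?]]]]]]; exists g0, g1, f0, f1. Qed.

Lemma mf_iso_trans M N P : mf_iso M N -> mf_iso N P -> mf_iso M P.
Proof.
case=> [f0 [f1 [g0 [g1 [[hf0 hf1 cf0 cf1] [hg0 hg1 _ _] [fK0 gK0] [fK1 gK1]]]]]].
case=> [f0' [f1' [g0' [g1' [[hf0' hf1' cf0' cf1'] [hg0' hg1' _ _]]]]]].
case=> [fK0' gK0'] [fK1' gK1'].
apply: (@mf_isoI M P (f0' \o f0) (f1' \o f1) (g0 \o g0') (g1 \o g1')).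
- by move=> a x y /=; rewrite !linearP.
- by move=> a x y /=; rewrite !linearP.
- exact: can_comp.
- exact: can_comp.
- exact: can_comp.
- exact: can_comp.
- by move=> d x /hf0 /hf0'.
- by move=> d x /hf1 /hf1'.
- by move=> d x /hg0' /hg0.
- by move=> d x /hg1' /hg1.
- by move=> x /=; rewrite cf0 cf0'.
- by move=> x /=; rewrite cf1 cf1'.
Qed.

End MFIso.

(** * An explicit model of Koszul factorizations and its shear isomorphisms *)

Section KoszulModel.
Context (S : comNzRingType).
Implicit Types (a b t : nat -> S) (n : nat) (e : bool).

Fixpoint kmod n : lmodType S :=
  if n is n'.+1 then (kmod n' * kmod n')%type : lmodType S else S^o.

(* The two summands of [kmod n.+1] are M_e and M_(~~ e) tensored with the even *)
(* and odd generator of the last row.                                          *)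
Fixpoint kdiff a b n e : kmod n -> kmod n :=
  match n return kmod n -> kmod n with
  | 0 => fun x => (if e then b 0 else a 0) *: x
  | n'.+1 => fun x =>
      (kdiff a b e x.1 + (if e then b n'.+1 else - b n'.+1) *: x.2,
       (if e then - a n'.+1 else a n'.+1) *: x.1 + kdiff a b (~~ e) x.2)
  end.

Lemma kdiff_is_linear a b n e : linear (@kdiff a b n e).
Proof.
elim: n e => [|n IH] e k x y /=; first by rewrite scalerDr !scalerA mulrC.
congr pair; rewrite /= IH !scalerDr !scalerA.
  by rewrite addrACA (mulrC _ k).
by rewrite addrACA (mulrC _ k).
Qed.
HB.instance Definition _ a b n e :=
  GRing.isLinear.Build S (kmod n) (kmod n) _ (@kdiff a b n e)
    (@kdiff_is_linear a b n e).

Lemma eq_kdiff a b a' b' n e :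
  (forall i, (i <= n)%N -> a i = a' i) -> (forall i, (i <= n)%N -> b i = b' i) ->
  @kdiff a b n e =1 @kdiff a' b' n e.
Proof.
elim: n e => [|n IH] e ha hb x /=; first by rewrite ha // hb.
by rewrite !IH ?ha ?hb // => i hi; rewrite (ha, hb) // ltnW.
Qed.

Lemma kdiffD a b a' b' n e x :
  @kdiff (fun i => a i + a' i) (fun i => b i + b' i) n e x
  = kdiff a b e x + kdiff a' b' e x.
Proof.
elim: n e x => [|n IH] e x /=.
  by case: e; rewrite scalerDl.
congr pair; rewrite /= IH; case: e => /=;
  by rewrite ?opprD !scalerDl addrACA.
Qed.

Lemma kdiffZ k a b n e x :
  @kdiff (fun i => k * a i) (fun i => k * b i) n e x = k *: kdiff a b e x.
Proof.
elim: n e x => [|n IH] e x /=; first by case: e; rewrite scalerA.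
congr pair; rewrite /= IH scalerDr; case: e => /=;
  by rewrite scalerA ?mulrN.
Qed.

(** The last row contributes [a n * b n]; the cross terms cancel because the signs of the last row
    flip with the parity [e]. *)
Lemma kdiffK a b n e x :
  @kdiff a b n (~~ e) (kdiff a b e x) = (\sum_(i < n.+1) a i * b i) *: x.
Proof.
elim: n e x => [|n IH] e x /=.
  by rewrite big_ord1 scalerA; case: e; rewrite //= mulrC.
case: x => x y; rewrite big_ord_recr /= negbK.
congr pair => /=.
  rewrite linearD linearZ_LR /= IH; move: (kdiff a b (~~ e) y) => u.
  case: e; rewrite /= scalerDr !scaleNr ?scalerN scalerDl scalerA addrACA;
    by rewrite ?subrr ?addNr addr0 ?opprK (mulrC (a _)).
have E := IH (~~ e) y; rewrite negbK in E.
have L k : kdiff a b e (k *: x) = k *: kdiff a b e x by rewrite linearZ_LR.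
rewrite scalerDr linearD /= L E {L}.
move: (kdiff a b e x) => u {E}.
case: e; rewrite /= !scaleNr ?scalerN scalerDl scalerA addrACA;
  by rewrite ?subrr ?addNr add0r ?opprK addrC.
Qed.

Section Graded.
Variables (homS : int -> S -> Prop).
Hypothesis homS0 : forall d, homS d 0.
Hypothesis homSB : forall d x y, homS d x -> homS d y -> homS d (x - y).
Hypothesis homS1 : homS 0 1.
Hypothesis homSM : forall (d c : int) x y, homS d x -> homS c y -> homS (d + c) (x * y).

Let homSN d x : homS d x -> homS d (- x).
Proof. by move=> hx; rewrite -[- x]add0r; apply: homSB. Qed.
Let homSD d x y : homS d x -> homS d y -> homS d (x + y).
Proof. by move=> hx hy; rewrite -[y]opprK; apply: homSB => //; apply: homSN. Qed.

Variable s : nat -> int.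

(** [s i] is the degree of the odd generator of row [i]. *)
Fixpoint khom n e (d : int) : kmod n -> Prop :=
  match n return kmod n -> Prop with
  | 0 => fun x => homS (d - (if e then s 0 else 0)) x
  | n'.+1 => fun x => khom e d x.1 /\ khom (~~ e) (d - s n'.+1) x.2
  end.

Lemma khom0 n e d : @khom n e d 0.
Proof. by elim: n e d => [|n IH] e d /=; [apply: homS0 | split; apply: IH]. Qed.

Lemma khomD n e d x y : @khom n e d x -> khom e d y -> khom e d (x + y).
Proof.
elim: n e d x y => [|n IH] e d x y /=; first exact: homSD.
by case=> hx1 hx2 [hy1 hy2]; split; apply: IH.
Qed.

Lemma khomZ n e d c k x : homS c k -> @khom n e d x -> khom e (c + d) (k *: x).
Proof.
elim: n e d x => [|n IH] e d x hk /=.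
  by move=> hx; rewrite -addrA; exact: (homSM hk hx).
by case=> hx1 hx2; split; rewrite -?addrA; apply: IH.
Qed.

Lemma khomN n e d x : @khom n e d x -> khom e d (- x).
Proof.
by move=> hx; rewrite -scaleN1r -[d]add0r; apply: khomZ => //; apply: homSN.
Qed.

(** Since e_i has degree [s i], each t_i e_i has degree [- c]. With [c = s n.+1], multiplying
    further by e_(n+1) preserves degrees, as a morphism must. *)
Lemma khom_kdiff t n e d c x : (forall i, (i <= n)%N -> homS (- c - s i) (t i)) ->
  @khom n e d x -> khom (~~ e) (d - c) (kdiff t (fun=> 0) e x).
Proof.
elim: n e d x => [|n IH] e d x ht /=.
  case: e => /= hx; first by rewrite scale0r; apply: homS0.
  have -> : d - c - s 0 = (- c - s 0) + (d - 0) by ring.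
  exact: (homSM (ht _ _) hx).
case=> hx1 hx2; have ht' i : (i <= n)%N -> homS (- c - s i) (t i).
  by move=> hi; apply: ht; rewrite ltnW.
split.
  rewrite oppr0 if_same scale0r addr0; exact: IH.
apply: khomD; last by rewrite addrAC; apply: IH.
have -> : d - c - s n.+1 = (- c - s n.+1) + d by ring.
rewrite negbK; apply: khomZ => //.
by case: (e); [apply: homSN|]; apply: ht.
Qed.

Definition kmodel a b n : mf_data S :=
  MFData (@kdiff a b n false : {linear GMod (@khom n false) -> GMod (@khom n true)})
         (@kdiff a b n true : {linear GMod (@khom n true) -> GMod (@khom n false)}).

Lemma eq_kmodel a a' b n : (forall i, (i <= n)%N -> a i = a' i) ->
  mf_iso (kmodel a b n) (kmodel a' b n).
Proof.
move=> ha; apply: (@mf_isoI _ (kmodel a b n) (kmodel a' b n) id id id id) => //= x;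
  exact: eq_kdiff.
Qed.

(** The isomorphism is tensored with the identity of the last row; the odd generator exchanges the
    roles of [f0] and [f1]. *)
Lemma kmodelS a a' b n : a n.+1 = a' n.+1 ->
  mf_iso (kmodel a b n) (kmodel a' b n) ->
  mf_iso (kmodel a b n.+1) (kmodel a' b n.+1).
Proof.
move=> han [f0 [f1 [g0 [g1 [[hf0 hf1 cf0 cf1] [hg0 hg1 _ _]]]]]].
case=> [fK0 gK0] [fK1 gK1].
apply: (@mf_isoI _ (kmodel a b n.+1) (kmodel a' b n.+1)
  (fun x => (f0 x.1, f1 x.2)) (fun x => (f1 x.1, f0 x.2))
  (fun x => (g0 x.1, g1 x.2)) (fun x => (g1 x.1, g0 x.2))) => /=.
- by move=> k x y; rewrite !linearP.
- by move=> k x y; rewrite !linearP.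
- by case=> x y; rewrite /= fK0 fK1.
- by case=> x y; rewrite /= gK0 gK1.
- by case=> x y; rewrite /= fK0 fK1.
- by case=> x y; rewrite /= gK0 gK1.
- by move=> d x [hx1 hx2]; split; [apply: hf0 | apply: hf1].
- by move=> d x [hx1 hx2]; split; [apply: hf1 | apply: hf0].
- by move=> d x [hx1 hx2]; split; [apply: hg0 | apply: hg1].
- by move=> d x [hx1 hx2]; split; [apply: hg1 | apply: hg0].
- move=> x; have := cf0 x.1; have := cf1 x.2 => /= e1 e0.
  by rewrite !linearD !linearZ_LR /= e0 e1 han.
- move=> x; have := cf1 x.1; have := cf0 x.2 => /= e1 e0.
  by rewrite !linearD !linearZ_LR /= e0 e1 han.
Qed.

Let shear_arith1 (V : zmodType) (u v p q r : V) :
  u + v + (q - p) = u + (- r - p) + (v + r + q).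
Proof. by rewrite [RHS](AC (1*2*3) ((1*4)*(6*3)*(5*2)))%AC /= subrr addr0. Qed.

Let shear_arith2 (V : zmodType) (u v p q r : V) :
  - u + v + (p + q) = (r + p - u) + (v - r + q).
Proof. by rewrite [RHS](AC (3*3) ((3*4)*(2*6)*(1*5)))%AC /= subrr addr0. Qed.

(* Conjugation by [1 + e_(n+1) h], where [h = kdiff t 0] squares to zero and   *)
(* anticommutes with the differential up to [sum_i t_i b_i].                   *)
Lemma kmodel_shear a b t n :
  (forall i, (i <= n)%N -> homS (- s n.+1 - s i) (t i)) ->
  mf_iso (kmodel a b n.+1)
    (kmodel (fun i => if i == n.+1 then a i - \sum_(j < n.+1) t j * b j
                      else a i + b n.+1 * t i) b n.+1).
Proof.
move=> ht; set a' := fun i => _; set c := \sum_(j < n.+1) _ in a' *.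
pose h e : {linear kmod n -> kmod n} := @kdiff t (fun=> 0) n e.
have hh e x : h (~~ e) (h e x) = 0.
  by rewrite /h /= kdiffK big1 ?scale0r // => i _; rewrite mulr0.
have dE e x : kdiff a' b e x = @kdiff a b n e x + b n.+1 *: h e x.
  rewrite -kdiffZ -kdiffD; apply: eq_kdiff => i hi.
    by rewrite /a' ltn_eqF.
  by rewrite mulr0 addr0.
have dh e x : @kdiff a b n (~~ e) (h e x) + h (~~ e) (kdiff a b e x) = c *: x.
  (* Polarisation: the identity for [a + t] minus the one for [a], where the square of [h]
     vanishes. *)
  have := kdiffK (fun i => a i + t i) (fun i => b i + 0) e x.
  rewrite !kdiffD !linearD /= kdiffK 
    -[kdiff t _ _ (kdiff t _ _ _)]/(h _ (h _ _)) hh addr0.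
  have -> : \sum_(i < n.+1) (a i + t i) * (b i + 0) = \sum_(i < n.+1) a i * b i + c.
    by rewrite -big_split; apply: eq_bigr => i _; rewrite addr0 mulrDl.
  rewrite scalerDl -addrA => /addrI <-.
  by rewrite addrC.
have kD p q e x y : @kdiff p q n e (x + y) = kdiff p q e x + kdiff p q e y.
  by rewrite linearD.
have kN p q e x : @kdiff p q n e (- x) = - kdiff p q e x by rewrite linearN.
have kZ p q e k x : @kdiff p q n e (k *: x) = k *: kdiff p q e x.
  by rewrite linearZ_LR.
have hhom e d x : @khom n e d x -> khom (~~ e) (d - s n.+1) (h e x).
  by apply: khom_kdiff => i; apply: ht.
have a'n : a' n.+1 = a n.+1 - c by rewrite /a' eqxx.
apply: (@mf_isoI _ (kmodel a b n.+1) (kmodel a' b n.+1)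
  (fun x => (x.1, x.2 + h false x.1)) (fun x => (x.1, x.2 - h true x.1))
  (fun x => (x.1, x.2 - h false x.1)) (fun x => (x.1, x.2 + h true x.1))) => /=.
- by move=> k x y; congr pair; rewrite /= linearP scalerDr addrACA.
- by move=> k x y; congr pair; rewrite /= linearP scalerBr opprD addrACA.
- by case=> x y /=; rewrite addrK.
- by case=> x y /=; rewrite addrNK.
- by case=> x y /=; rewrite addrNK.
- by case=> x y /=; rewrite addrK.
- by move=> d x [hx1 hx2]; split=> //; apply: khomD => //; apply: (hhom false).
- move=> d x [hx1 hx2]; split=> //; apply: khomD => //; apply: khomN.
  exact: (hhom true).
- move=> d x [hx1 hx2]; split=> //; apply: khomD => //; apply: khomN.
  exact: (hhom false).
- by move=> d x [hx1 hx2]; split=> //; apply: khomD => //; apply: (hhom true).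
- case=> x y; rewrite /= !dE a'n; congr pair => /=.
    by rewrite !scaleNr scalerDr opprD [- (_ *: y) - _]addrC addrA addrK.
  have := (dh false x, hh false x); rewrite /h /= => -[dhx hhx].
  rewrite !kD kZ hhx addr0 scalerBl -dhx.
  rewrite scaleNr opprB opprD; exact: shear_arith1.
- case=> x y; rewrite /= !dE a'n; congr pair => /=.
    by rewrite scalerBr addrA addrAC addrK.
  have := (dh true x, hh true x); rewrite /h /= => -[dhx hhx].
  rewrite !kD kZ !kN hhx subr0.
  rewrite scaleNr opprB scalerBl -dhx; exact: shear_arith2.
Qed.

(** The shear by the last column of [T] adds that column's contribution to the earlier rows and, by
    antisymmetry, the whole contribution of the last row. The remaining block is the induction
    hypothesis, extended by [kmodelS]. *)
Lemma kmodel_antisym a b T n :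
  (forall i, T i i = 0) -> (forall i j, T i j = - T j i) ->
  (forall i j, (i <= n)%N -> (j <= n)%N -> homS (- s i - s j) (T i j)) ->
  mf_iso (kmodel a b n)
         (kmodel (fun i => a i + \sum_(j < n.+1) T i j * b j) b n).
Proof.
move=> T0 TN; elim: n a => [|n IH] a hT.
  apply: eq_kmodel => i; rewrite leqn0 => /eqP ->.
  by rewrite big_ord1 T0 mul0r addr0.
have ht i : (i <= n)%N -> homS (- s n.+1 - s i) (T i n.+1).
  by move=> hi; rewrite addrC; apply: hT => //; apply: ltnW.
apply: mf_iso_trans (kmodel_shear a b ht) _; set a1 := fun i => _.
have hT' i j : (i <= n)%N -> (j <= n)%N -> homS (- s i - s j) (T i j).
  by move=> hi hj; apply: hT; apply: ltnW.
pose a2 i := if i == n.+1 then a1 i else a1 i + \sum_(j < n.+1) T i j * b j.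
apply: (@mf_iso_trans _ _ (kmodel a2 b n.+1)).
  apply: kmodelS; first by rewrite /a2 eqxx.
  apply: mf_iso_trans (IH a1 hT') _.
  by apply: eq_kmodel => i hi; rewrite /a2 ltn_eqF.
apply: eq_kmodel => i hi; rewrite /a2 /a1 [in RHS]big_ord_recr /=.
case: eqVneq => [->|ni].
  rewrite T0 mul0r addr0 -sumrN; congr (_ + _); apply: eq_bigr => j _.
  by rewrite (TN n.+1) mulNr.
by rewrite mulrC -addrA; congr (_ + _); rewrite addrC.
Qed.

(** * Comparison of the model with iterated tensor products *)

Lemma tensor_lin_ext (M N V : lmodType S) (g h : tensor M N -> V) :
  linear g -> linear h ->
  (forall x y, g (tensor_pure x y) = h (tensor_pure x y)) -> g =1 h.
Proof.
move=> lg lh.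
pose G : {linear _ -> _} := HB.pack g (GRing.isLinear.Build _ _ _ _ g lg).
pose H : {linear _ -> _} := HB.pack h (GRing.isLinear.Build _ _ _ _ h lh).
exact: (@tensor_lift_uniq _ _ _ _ G H).
Qed.

Section TensorUnit.
Variables (M V : lmodType S) (f : {linear M -> V}).

Definition tensor_unit_pure (x : M) (c : S^o) : V := (c : S) *: f x.

Fact tensor_unit_pure_is_bilinear : bilinear_for *:%R *:%R tensor_unit_pure.
Proof.
split=> [c k x y | x k c c']; rewrite /tensor_unit_pure.
  by rewrite linearP scalerDr scalerA mulrC -scalerA.
by rewrite scalerDl -scalerA.
Qed.
HB.instance Definition _ := bilinear_isBilinear.Build S M S^o V _ _
  tensor_unit_pure tensor_unit_pure_is_bilinear.

(** The canonical isomorphism of M tensor S with M, followed by [f]. *)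
Definition tensor_unit : tensor M S^o -> V := tensor_lift tensor_unit_pure.
HB.instance Definition _ := GRing.Linear.on tensor_unit.

Lemma tensor_unitE x c : tensor_unit (tensor_pure x c) = (c : S) *: f x.
Proof. exact: tensor_liftE. Qed.

Lemma tensor_unitK (g : {linear V -> M}) : cancel f g ->
  cancel tensor_unit (fun v => tensor_pure (g v) (1 : S^o)).
Proof.
move=> fK; apply: tensor_lin_ext => [k x y|//|x c].
  by rewrite !linearP linearPl.
rewrite tensor_unitE linearZ_LR fK linearZl_LR -linearZr_LR.
by congr tensor_pure; apply: mulr1.
Qed.

Lemma tensor_unitVK (g : {linear V -> M}) : cancel g f ->
  cancel (fun v => tensor_pure (g v) (1 : S^o)) tensor_unit.
Proof. by move=> gK v; rewrite tensor_unitE gK scale1r. Qed.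

End TensorUnit.

Lemma tensor_unit_id (M V : lmodType S) (f : {linear M -> V}) (c : S) x :
  tensor_unit f (tensor_map idfun (c \*: idfun : {linear S^o -> S^o}) x) =
  c *: tensor_unit f x.
Proof.
move: x; apply: tensor_lin_ext => [k x y|k x y|x y].
- by rewrite !linearP.
- by rewrite linearP scalerDr !scalerA mulrC.
- by rewrite tensor_mapE !tensor_unitE -scalerA.
Qed.

Lemma tensor_unit_map (M N V W : lmodType S) (f : {linear M -> V})
    (g : {linear N -> W}) (d : {linear M -> N}) (d' : {linear V -> W}) x :
  (forall x, g (d x) = d' (f x)) ->
  tensor_unit g (tensor_map d idfun x) = d' (tensor_unit f x).
Proof.
move=> gd; move: x; apply: tensor_lin_ext => [k x y|k x y|x y].
- by rewrite !linearP.
- by rewrite !linearP.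
- by rewrite tensor_mapE !tensor_unitE gd linearZ_LR.
Qed.

Lemma tensor_kmodel (M : mf_data S) (r : koszul_row S) a b n :
  a n.+1 = krow_a r -> b n.+1 = krow_b r ->
  s n.+1 = ((krow_degb r - krow_dega r) %/ 2)%Z ->
  mf_iso M (kmodel a b n) ->
  mf_iso (mf_tensor M (koszul1 homS r)) (kmodel a b n.+1).
Proof.
move=> ha hb hs [f0 [f1 [g0 [g1 [[hf0 hf1 cf0 cf1] [hg0 hg1 _ _]]]]]].
case=> [fK0 gK0] [fK1 gK1].
have unit_hom (N : gmod S) e (f : {linear N -> kmod n}) sh d x :
    (forall d x, ghom N d x -> khom e d (f x)) ->
    ghom (tensor_gmod N (shift_gmod sh (reg_gmod homS))) d x ->
    khom e (d - sh) (tensor_unit f x).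
  move=> hf [q [hq ->]]; rewrite linear_sum /=.
  rewrite big_seq; elim/big_ind: _ => [|u v|p /hq [i [j [<- hp1 hp2]]]].
  - exact: khom0.
  - exact: khomD.
  rewrite tensor_unitE -addrA addrC.
  by apply: khomZ => //; apply: hf.
have pure_hom (N : gmod S) e (g : {linear kmod n -> N}) sh d x :
    (forall d x, khom e d x -> ghom N d (g x)) ->
    khom e (d - sh) x ->
    ghom (tensor_gmod N (shift_gmod sh (reg_gmod homS))) d
      (tensor_pure (g x) (1 : S^o)).
  move=> hg hx; exists [:: (g x, 1 : S^o)]; split; last by rewrite big_seq1.
  move=> p; rewrite inE => /eqP -> /=; exists (d - sh), sh.
  by rewrite addrNK subrr; split=> //; apply: hg.
(* The even part of a Koszul row is unshifted; as a shift by 0 it falls under [unit_hom] and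
   [pure_hom]. *)
have shift0 (N : gmod S) d x : ghom (tensor_gmod N (reg_gmod homS)) d x <->
    ghom (tensor_gmod N (shift_gmod 0 (reg_gmod homS))) d x.
  split=> -[q [hq xE]]; exists q; split=> // p /hq [i [j [? ? hp]]];
    by exists i, j; move: hp; rewrite /= subr0.
apply: (@mf_isoI _ (mf_tensor M (koszul1 homS r)) (kmodel a b n.+1)
  (fun x => (tensor_unit f0 x.1, tensor_unit f1 x.2))
  (fun x => (tensor_unit f1 x.1, tensor_unit f0 x.2))
  (fun x => (tensor_pure (g0 x.1) (1 : S^o), tensor_pure (g1 x.2) (1 : S^o)))
  (fun x => (tensor_pure (g1 x.1) (1 : S^o), tensor_pure (g0 x.2) (1 : S^o)))).
- by move=> k x y; rewrite /= !linearP.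
- by move=> k x y; rewrite /= !linearP.
- by case=> x y /=; congr pair; apply: tensor_unitK.
- by case=> x y /=; congr pair; apply: tensor_unitVK.
- by case=> x y /=; congr pair; apply: tensor_unitK.
- by case=> x y /=; congr pair; apply: tensor_unitVK.
- move=> d x [/shift0 hx1 hx2]; split; rewrite /= ?hs; last exact: unit_hom hx2.
  by have := unit_hom _ _ _ _ _ _ hf0 hx1; rewrite subr0.
- move=> d x [/shift0 hx1 hx2]; split; rewrite /= ?hs; last exact: unit_hom hx2.
  by have := unit_hom _ _ _ _ _ _ hf1 hx1; rewrite subr0.
- move=> d x [hx1 hx2]; split; rewrite /= in hx2 *.
    by apply/shift0; apply: pure_hom hg0 _; rewrite subr0.
  by rewrite hs in hx2; apply: pure_hom hg1 _.
- move=> d x [hx1 hx2]; split; rewrite /= in hx2 *.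
    by apply/shift0; apply: pure_hom hg1 _; rewrite subr0.
  by rewrite hs in hx2; apply: pure_hom hg0 _.
- case=> x y /=; rewrite !ha !hb; congr pair => /=.
    rewrite linearB /= (tensor_unit_map _ cf0) tensor_unit_id.
    by rewrite scaleNr.
  by rewrite linearD /= (tensor_unit_map _ cf1) tensor_unit_id.
- case=> x y /=; rewrite !ha !hb; congr pair => /=.
    by rewrite linearD /= (tensor_unit_map _ cf1) tensor_unit_id.
  rewrite linearD linearN /= (tensor_unit_map _ cf0) tensor_unit_id.
  by rewrite scaleNr.
Qed.

Lemma koszul_kmodel (row : nat -> koszul_row S) n :
  (forall i, s i = ((krow_degb (row i) - krow_dega (row i)) %/ 2)%Z) ->
  mf_iso (koszul homS (row 0) [seq row i.+1 | i <- iota 0 n])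
         (kmodel (fun i => krow_a (row i)) (fun i => krow_b (row i)) n).
Proof.
move=> hs; elim: n => [|n IH].
  apply: (@mf_isoI _ (koszul1 homS (row 0)) (kmodel _ _ 0) id id id id) => //=;
    by move=> d x; rewrite ?subr0 // hs.
rewrite -addn1 iotaD map_cat /koszul foldl_cat /= add0n addn1.
exact: tensor_kmodel.
Qed.

End Graded.
End KoszulModel.

(** * Graded polynomials and graded free modules *)

Section GradedPolynomials.
Variables (k : nat) (wt : 'I_k -> nat).
Local Notation R := {mpoly rat[k]}.
Local Notation homR := (homR wt).
Implicit Types (p q : R) (d e : int).

Lemma homRP d p :
  homR d p <-> (forall m, (wdeg wt m)%:Z != d -> p@_m = 0).
Proof.
case: d => n /=; last first.
  split=> [-> m _|H]; first by rewrite mcoeff0.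
  by apply/mpolyP => m; rewrite mcoeff0 H.
split=> [hp m hm|H]; first by apply: dhomog_nemf_coeff hp _.
apply/dhomogP => m; rewrite mcoeff_msupp => hm.
by apply/eqP; apply: contraNT hm => hm; rewrite H.
Qed.

Definition hproj d p : R :=
  \sum_(m <- msupp p | (wdeg wt m)%:Z == d) p@_m *: 'X_[m].

Lemma mcoeff_hproj d p m :
  (hproj d p)@_m = if (wdeg wt m)%:Z == d then p@_m else 0.
Proof.
rewrite /hproj linear_sum /= big_mkcond /=.
under eq_bigr => m' _ do rewrite mcoeffZ mcoeffX.
have [hm|hm] := boolP (m \in msupp p).
  rewrite (bigD1_seq m) //= eqxx mulr1 big1 ?addr0 // => m' /negPf ->.
  by rewrite mulr0 if_same.
rewrite (memN_msupp_eq0 hm) if_same big_seq big1 // => m' hm'.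
case: eqP => // _; case: eqP => [E|_]; last by rewrite mulr0.
by rewrite -E hm' in hm.
Qed.

Lemma hproj_linear d : linear (hproj d).
Proof.
move=> c p q; apply/mpolyP => m; rewrite mcoeffD mcoeffZ !mcoeff_hproj.
by case: eqP => _; rewrite ?mulr0 ?addr0 // mcoeffD mcoeffZ.
Qed.
HB.instance Definition _ d :=
  GRing.isLinear.Build rat R R _ (hproj d) (hproj_linear d).

Lemma homR_hproj d p : homR d (hproj d p).
Proof. by apply/homRP => m hm; rewrite mcoeff_hproj (negPf hm). Qed.

Lemma hproj_id d p : homR d p -> hproj d p = p.
Proof.
move=> /homRP hp; apply/mpolyP => m; rewrite mcoeff_hproj.
by case: ifPn => // /hp ->.
Qed.

Lemma hproj_eq0 d e p : homR d p -> d != e -> hproj e p = 0.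
Proof.
move=> /homRP hp hde; apply/mpolyP => m; rewrite mcoeff_hproj mcoeff0.
by case: eqP => // E; apply: hp; rewrite E eq_sym.
Qed.

(** Multiplication by a homogeneous [q] shifts every degree by [e]. This allows the coefficients in
    a homogeneous relation to be replaced by homogeneous components. *)
Lemma hprojM d e p q : homR e q -> hproj (d + e) (p * q) = hproj d p * q.
Proof.
move=> /homRP hq; apply/mpolyP => m; rewrite mcoeff_hproj !mcoeffM.
have key (m1 m2 : 'X_{1..k}) : m = (m1 + m2)%MM ->
    (hproj d p)@_m1 * q@_m2 =
    if (wdeg wt m)%:Z == d + e then p@_m1 * q@_m2 else 0.
  move=> ->; rewrite wdegD PoszD mcoeff_hproj.
  have [<-|/hq ->] := eqVneq (wdeg wt m2)%:Z e; last by rewrite !mulr0 if_same.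
  by rewrite (inj_eq (addIr _)); case: ifP => _; rewrite // mul0r.
case: ifPn => hm; last rewrite big1 //.
  by apply: eq_bigr => -[m1 m2] /= /eqP /key ->; rewrite hm.
by move=> -[m1 m2] /= /eqP /key ->; rewrite (negPf hm).
Qed.

Lemma homRM d e p q : homR d p -> homR e q -> homR (d + e) (p * q).
Proof.
by move=> hp hq; rewrite -(hproj_id hp) -(hprojM d p hq); apply: homR_hproj.
Qed.

Lemma homR0 d : homR d 0.
Proof. by apply/homRP => m _; rewrite mcoeff0. Qed.

Lemma homRD d p q : homR d p -> homR d q -> homR d (p + q).
Proof.
by move=> /homRP hp /homRP hq; apply/homRP => m h; rewrite mcoeffD hp ?hq ?addr0.
Qed.

Lemma homRN d p : homR d p -> homR d (- p).
Proof. by move=> /homRP hp; apply/homRP => m h; rewrite mcoeffN hp ?oppr0. Qed.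

Lemma homR1 : homR 0 1.
Proof. exact: dhomog1. Qed.

Lemma homR_sum d (I : Type) (r : seq I) (P : pred I) (F : I -> R) :
  (forall i, P i -> homR d (F i)) -> homR d (\sum_(i <- r | P i) F i).
Proof.
move=> hF; elim/big_ind: _ => //; [exact: homR0 | exact: homRD].
Qed.

Lemma sum_hproj e p (s : seq int) : uniq s ->
  (forall m, m \in msupp p -> (wdeg wt m)%:Z + e \in s) ->
  \sum_(d <- s) hproj (d - e) p = p.
Proof.
move=> us hs; apply/mpolyP => m; rewrite linear_sum /=.
under eq_bigr => d _ do rewrite mcoeff_hproj eq_sym subr_eq.
have [hm|hm] := boolP (m \in msupp p).
  rewrite (bigD1_seq _ (hs m hm) us) /= eqxx big1 ?addr0 // => d /negPf ->.
  by [].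
by rewrite (memN_msupp_eq0 hm) big1 // => d _; rewrite if_same.
Qed.

(** A graded isomorphism with a finite direct sum of modules R{[deg i]}, given by coordinate
    functions so that it is easily carried along graded isomorphisms. *)
Definition graded_coords (M : gmod R) : Prop :=
  exists (I : finType) (deg : I -> int) (kappa : M -> I -> R),
    [/\ forall c x y i, kappa (c *: x + y) i = c * kappa x i + kappa y i,
        forall x y, kappa x =1 kappa y -> x = y,
        forall u : I -> R, exists x, kappa x =1 u
      & forall d x, ghom M d x <-> forall i, homR (d - deg i) (kappa x i)].

Lemma graded_coords_free (M : gmod R) :
  graded_coords M -> is_free_graded homR M.
Proof.
case=> [I [deg [kappa [klin kinj ksurj khom]]]].
have k0 i : kappa 0 i = 0.
  by have := klin (-1) 0 0 i; rewrite scaler0 addr0 mulN1r addNr.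
have kD x y i : kappa (x + y) i = kappa x i + kappa y i.
  by rewrite -[x]scale1r klin mul1r scale1r.
have kZ c x i : kappa (c *: x) i = c * kappa x i.
  by rewrite -[c *: x]addr0 klin k0 addr0.
have kN x i : kappa (- x) i = - kappa x i by rewrite -scaleN1r kZ mulN1r.
have ksum (J : Type) (r : seq J) (F : J -> M) i :
    kappa (\sum_(j <- r) F j) i = \sum_(j <- r) kappa (F j) i.
  by rewrite (big_morph (kappa^~ i) (fun x y => kD x y i) (k0 i)).
have /fin_all_exists [e eE] : forall i, exists x, forall j, kappa x j = (j == i)%:R.
  by move=> i; case: (ksurj (fun j => (j == i)%:R)) => x hx; exists x.
have kcomb u j : kappa (\sum_(i : I) u i *: e i) j = u j.
  rewrite ksum (bigD1 j) //= kZ eE eqxx mulr1 big1 ?addr0 // => i hi.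
  by rewrite kZ eE eq_sym (negPf hi) mulr0.
split; last first.
  exists I, e; split; first split.
  - move=> x; exists (index_enum I), (kappa x); apply: kinj => j.
    by rewrite kcomb.
  - move=> s c us hs i hi; have := ksum _ s (fun i => c i *: e i) i.
    rewrite hs k0 (bigD1_seq i) //= kZ eE eqxx mulr1 big1 ?addr0 // => j hj.
    by rewrite kZ eE eq_sym (negPf hj) mulr0.
  - move=> i; exists (deg i); apply/khom => j; rewrite eE.
    by case: eqP => [->|_]; [rewrite subrr; apply: homR1 | apply: homR0].
split; last first.
  move=> i j c x hc /khom hx; apply/khom => l; rewrite kZ -addrA.
  exact: homRM.
split.
- by move=> d; apply/khom => i; rewrite k0; apply: homR0.
- move=> d x y /khom hx /khom hy; apply/khom => i; rewrite kD kN.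
  by apply: homRD => //; apply: homRN.
- move=> x.
  (* The degrees that occur in [x]; the part of degree [d] has the components of degree [d - deg i]
     as its coordinates. *)
  pose s := undup (flatten [seq [seq (wdeg wt m)%:Z + deg i | m <- msupp (kappa x i)]
                           | i <- enum I]).
  exists s, (fun d => \sum_i hproj (d - deg i) (kappa x i) *: e i); split.
    by move=> d; apply/khom => i; rewrite kcomb; apply: homR_hproj.
  apply: kinj => i; rewrite ksum; under eq_bigr => d _ do rewrite kcomb.
  rewrite sum_hproj ?undup_uniq // => m hm; rewrite mem_undup.
  apply/flattenP; exists [seq (wdeg wt m)%:Z + deg i | m <- msupp (kappa x i)].
    by apply/mapP; exists i; rewrite ?mem_enum.
  by apply/mapP; exists m.
- move=> s c us hc hs d hd; apply: kinj => i; rewrite k0.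
  have hk d' : homR (d' - deg i) (kappa (c d') i).
    by have /khom := hc d'; apply.
  have := congr1 (fun x => hproj (d - deg i) (kappa x i)) hs.
  rewrite k0 linear0 ksum linear_sum /= (bigD1_seq d) //= big1 => [|d' hd'].
    by rewrite addr0 hproj_id.
  by apply: (hproj_eq0 (hk d')); rewrite (inj_eq (addIr _)).
Qed.

Lemma graded_coords_iso (M N : gmod R) (f : M -> N) (g : N -> M) :
  linear f -> cancel f g -> cancel g f ->
  (forall d x, ghom M d x -> ghom N d (f x)) ->
  (forall d x, ghom N d x -> ghom M d (g x)) ->
  graded_coords N -> graded_coords M.
Proof.
move=> lf fK gK hf hg [I [deg [kappa [klin kinj ksurj khom]]]].
exists I, deg, (fun x => kappa (f x)); split.
- by move=> c x y i; rewrite lf klin.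
- by move=> x y /kinj /(can_inj fK).
- by move=> u; case: (ksurj u) => x hx; exists (g x); rewrite gK.
- move=> d x; split=> [/hf /(khom d (f x)).1 //|hx].
  by rewrite -[x]fK; apply/hg/khom.
Qed.

End GradedPolynomials.

(** * The quotient ring *)

Section QuotientRing.
Variables (k : nat) (wt : 'I_k -> nat).
Local Notation R := {mpoly rat[k]}.
Variables (l : nat) (alpha : 'I_l -> R) (dy : nat).
Local Notation homR := (homR wt).
Local Notation homRX := (homRX wt dy).
Local Notation homRy := (@Defs.homRy k l alpha wt dy).
Local Notation yrel := (yrel alpha).
Local Notation Ry := (Ry alpha).
Local Notation iota := (RtoRy alpha).
Implicit Types (P Q : {poly R}) (x y : Ry) (d : int) (c : R).

Lemma homRX0 d : homRX d 0.
Proof. by move=> j; rewrite coef0; apply: homR0. Qed.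

Lemma homRXD d P Q : homRX d P -> homRX d Q -> homRX d (P + Q).
Proof. by move=> hP hQ j; rewrite coefD; apply: homRD. Qed.

Lemma homRXN d P : homRX d P -> homRX d (- P).
Proof. by move=> hP j; rewrite coefN; apply: homRN. Qed.

Lemma homRX_sum d (I : Type) (r : seq I) (C : pred I) (F : I -> {poly R}) :
  (forall i, C i -> homRX d (F i)) -> homRX d (\sum_(i <- r | C i) F i).
Proof.
by move=> hF; elim/big_ind: _ => //; [exact: homRX0 | exact: homRXD].
Qed.

Lemma homRXM d (e : int) P Q : homRX d P -> homRX e Q -> homRX (d + e) (P * Q).
Proof.
move=> hP hQ j; rewrite coefM; apply: homR_sum => i _.
have -> : d + e - (j * dy)%:Z = (d - (i * dy)%:Z) + (e - ((j - i) * dy)%:Z).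
  by have := ltn_ord i; nia.
exact: homRM.
Qed.

Lemma homRXC d c : homR d c -> homRX d c%:P.
Proof.
move=> hc [|j]; rewrite coefC /=; last exact: homR0.
by rewrite mul0n subr0.
Qed.

Lemma homRXZ d (e : int) c P : homR d c -> homRX e P -> homRX (d + e) (c *: P).
Proof. by move=> hc hP; rewrite -mul_polyC; apply: homRXM => //; apply: homRXC. Qed.

Lemma homRXXn n : homRX (n * dy)%:Z 'X^n.
Proof.
move=> j; rewrite coefXn; case: eqP => [->|_]; last exact: homR0.
by rewrite subrr; apply: homR1.
Qed.

(** The quotient is built linearly from X^j - (-beta)^j = (X + beta) [S j], where the geometric sum
    [S j] is visibly homogeneous and of size at most [j]. *)
Lemma div_XaddC d P beta : homRX d P -> homR dy beta ->
  exists Q, [/\ homRX (d - dy%:Z) Q, (size Q <= (size P).-1)%N,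
    homR d P.[- beta] & P = Q * ('X + beta%:P) + (P.[- beta])%:P].
Proof.
move=> hP hbeta.
pose S j : {poly R} := \sum_(i < j) 'X^(j.-1 - i) * ((- beta) ^+ i)%:P.
have hpow i : homR (i * dy)%:Z ((- beta) ^+ i).
  elim: i => [|i IH]; first exact: homR1.
  by rewrite exprS mulSn PoszD; apply: homRM => //; apply: homRN.
have SE j : 'X^j - ((- beta) ^+ j)%:P = ('X + beta%:P) * S j.
  have -> : 'X + beta%:P = 'X - (- beta)%:P by rewrite polyCN opprK.
  rewrite polyC_exp subrXX; congr (_ * _); apply: eq_bigr => i _.
  by rewrite -subn1 -subnDA add1n polyC_exp.
have hS j : homRX ((j.-1 * dy)%:Z) (S j).
  apply: homRX_sum => i _.
  have -> : ((j.-1 * dy)%:Z = ((j.-1 - i) * dy)%:Z + (i * dy)%:Z)%R.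
    by have := ltn_ord i; nia.
  by apply: homRXM; [apply: homRXXn | apply: homRXC].
have sS j : (size (S j) <= j)%N.
  apply: leq_trans (size_sum _ _ _) _; apply/bigmax_leqP => i _.
  rewrite mulrC mul_polyC; apply: leq_trans (size_scale_leq _ _) _.
  by rewrite size_polyXn; have := ltn_ord i; lia.
exists (\sum_(j < size P) P`_j *: S j); split.
- apply: homRX_sum => -[[|j] hj] _ /=.
    by rewrite /S big_ord0 scaler0; apply: homRX0.
  have -> : (d - dy%:Z = (d - (j.+1 * dy)%:Z) + (j * dy)%:Z)%R by nia.
  by apply: homRXZ (hS j.+1).
- apply: leq_trans (size_sum _ _ _) _; apply/bigmax_leqP => i _.
  apply: leq_trans (size_scale_leq _ _) _; apply: leq_trans (sS _) _.
  by have := ltn_ord i; lia.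
- rewrite horner_coef; apply: homR_sum => i _.
  by rewrite -[d](subrK (i * dy)%:Z); apply: homRM.
rewrite horner_coef rmorph_sum /= mulr_suml -big_split /=.
rewrite -[LHS]coefK poly_def; apply: eq_bigr => i _.
by rewrite -scalerAl mulrC -SE polyCM mul_polyC -scalerDr subrK.
Qed.

(** * Reduced representatives, the grading of the quotient, and freeness over R *)

Definition pR : {poly R} -> Ry := in_qpoly yrel.
HB.instance Definition _ := GRing.RMorphism.on pR.
Definition rep (x : Ry) : {poly R} := (x : {poly %/ yrel}) : {poly R}.
Arguments rep : simpl never.
Arguments pR : simpl never.

Lemma size_yrel_tail :
  (size (\sum_(i < l) (alpha i)%:P * 'X^(l - i.+1))%R <= l)%N.
Proof.
apply: (leq_trans (size_sum _ _ _)); apply/bigmax_leqP => i _.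
rewrite mul_polyC; apply: leq_trans (size_scale_leq _ _) _.
by rewrite size_polyXn; have := ltn_ord i; lia.
Qed.

Lemma size_yrel : size yrel = l.+1.
Proof. by rewrite /Defs.yrel size_polyDl size_polyXn // ltnS size_yrel_tail. Qed.

Lemma yrel_monic : yrel \is monic.
Proof.
rewrite monicE lead_coefE size_yrel /= /Defs.yrel coefD coefXn eqxx.
by rewrite nth_default ?addr0 // size_yrel_tail.
Qed.

Hypothesis l_gt0 : (0 < l)%N.

(** The quotient is taken modulo [mk_monic yrel], which is a default polynomial unless [yrel] is
    monic and not constant; hence the condition on [l]. *)
Lemma mk_monic_yrel : mk_monic yrel = yrel.
Proof. by rewrite /mk_monic size_yrel yrel_monic !ltnS l_gt0. Qed.

Lemma size_rep x : (size (rep x) <= l)%N.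
Proof.
by rewrite -ltnS -size_yrel -[in X in (_ < X)%N]mk_monic_yrel size_mk_monic.
Qed.

Lemma rep_pR (P : {poly R}) : (size P <= l)%N -> rep (pR P) = P.
Proof.
by move=> hP; apply: in_qpoly_small; rewrite mk_monic_yrel size_yrel.
Qed.

Lemma repK x : pR (rep x) = x.
Proof. by apply: val_inj; apply: rep_pR; apply: size_rep. Qed.

Lemma rep_inj : injective rep.
Proof. exact: can_inj repK. Qed.

Lemma repD x y : rep (x + y) = rep x + rep y. Proof. by []. Qed.

Lemma pRC c : pR c%:P = iota c.
Proof.
apply: rep_inj; rewrite rep_pR //.
by rewrite (leq_trans (size_polyC_leq1 _)).
Qed.

Lemma pRD P Q : pR (P + Q) = pR P + pR Q. Proof. exact: rmorphD. Qed.

Lemma pRB P Q : pR (P - Q) = pR P - pR Q. Proof. exact: rmorphB. Qed.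

Lemma pRM P Q : pR (P * Q) = pR P * pR Q. Proof. exact: rmorphM. Qed.

Lemma pRZ c P : pR (c *: P) = iota c * pR P.
Proof. by rewrite -mul_polyC pRM pRC. Qed.

Lemma pR_sum (I : Type) (r : seq I) (F : I -> {poly R}) :
  pR (\sum_(i <- r) F i) = \sum_(i <- r) pR (F i).
Proof. exact: rmorph_sum. Qed.

Lemma pRX : pR 'X = yvar alpha. Proof. by []. Qed.

Lemma pR_yrel : pR yrel = 0.
Proof.
apply: val_inj; rewrite /= mk_monic_yrel.
by rewrite Pdiv.RingMonic.rmodpp // yrel_monic.
Qed.

Lemma rep_iota c : rep (iota c) = c%:P. Proof. by []. Qed.

Lemma repZ c x : rep (iota c * x) = c *: rep x.
Proof.
rewrite -{1}[x]repK -pRC -rmorphM rep_pR mul_polyC //.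
exact: leq_trans (size_scale_leq _ _) (size_rep _).
Qed.

Hypothesis yrel_homog : homRX (l * dy)%:Z yrel.

(** By linearity it suffices to reduce powers of X, one multiplication by X at a time. Homogeneity
    in R_y can therefore be tested on the coefficients of the reduced representative. *)
Lemma homRX_rep_pR d P : homRX d P -> homRX d (rep (pR P)).
Proof.
move=> hP; rewrite -[P]coefK poly_def rmorph_sum /=.
have rep_sum n (F : 'I_n -> Ry) : rep (\sum_i F i) = \sum_i rep (F i).
  by rewrite (big_morph rep repD (erefl _)).
rewrite rep_sum; apply: homRX_sum => j _.
rewrite -mul_polyC rmorphM /= pRC repZ.
have -> : d = (d - (j * dy)%:Z) + (j * dy)%:Z by rewrite subrK.
apply: homRXZ => //; elim: (nat_of_ord j) => {j hP P rep_sum} [|j IH].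
  by rewrite expr0 rep_pR ?size_poly1 //; apply: homRXXn 0%N.
set x := pR 'X^j in IH; rewrite exprS rmorphM -/x.
pose Q := 'X * rep x.
(* [Q] has degree at most [l], so a single subtraction of a multiple of the monic [yrel] reduces
   it. *)
have -> : pR 'X * x = pR (Q - Q`_l *: yrel).
  by rewrite rmorphB -[_ *: yrel]mul_polyC !rmorphM /= pR_yrel mulr0 subr0 repK.
have hQ : homRX (j.+1 * dy)%:Z Q.
  by rewrite mulSn PoszD; apply: homRXM => //; have := homRXXn 1; rewrite mul1n.
rewrite rep_pR; last first.
  apply/leq_sizeP => i; rewrite leq_eqVlt => /orP[/eqP <-|hi].
    have := yrel_monic; rewrite monicE lead_coefE size_yrel /= => /eqP.
    by rewrite coefB coefZ => ->; rewrite mulr1 subrr.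
  rewrite coefB coefZ [yrel`_i]nth_default ?size_yrel // mulr0 subr0.
  rewrite coefXM; case: i hi => // i hi; rewrite /= nth_default //.
  exact: leq_trans (size_rep _) hi.
apply: (homRXD hQ); apply: homRXN.
rewrite -[Posz (j.+1 * dy)](subrK (Posz (l * dy))); exact: homRXZ (hQ l) yrel_homog.
Qed.

Lemma homRyE d x : homRy d x <-> homRX d (rep x).
Proof.
split=> [[P hP ->]|hx]; first exact: homRX_rep_pR.
by exists (rep x) => //; rewrite -[in LHS](repK x).
Qed.

Lemma homRy_pR d P : homRX d P -> homRy d (pR P).
Proof. by exists P. Qed.

Lemma homRy_iota d c : homRy d (iota c) <-> homR d c.
Proof.
split=> [/homRyE /(_ 0%N)|hc]; first by rewrite rep_iota coefC mul0n subr0.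
by apply/homRyE; rewrite rep_iota; apply: homRXC.
Qed.

Lemma homRy0 d : homRy d 0.
Proof. by apply/homRyE; apply: homRX0. Qed.

Lemma homRyD d x y : homRy d x -> homRy d y -> homRy d (x + y).
Proof. by move=> /homRyE hx /homRyE hy; apply/homRyE; apply: homRXD. Qed.

Lemma homRyN d x : homRy d x -> homRy d (- x).
Proof. by move=> /homRyE hx; apply/homRyE; apply: homRXN. Qed.

Lemma homRyB d x y : homRy d x -> homRy d y -> homRy d (x - y).
Proof. by move=> hx hy; apply: homRyD => //; apply: homRyN. Qed.

Lemma homRyM d (e : int) x y : homRy d x -> homRy e y -> homRy (d + e) (x * y).
Proof.
move=> /homRyE hx /homRyE hy; rewrite -[x]repK -[y]repK -rmorphM.
by apply: homRy_pR; apply: homRXM.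
Qed.

Lemma homRy1 : homRy 0 1.
Proof. by rewrite -(rmorph1 iota); apply/homRy_iota; apply: homR1. Qed.

Lemma homRy_yvar : homRy dy (yvar alpha).
Proof. by apply: homRy_pR; have := homRXXn 1; rewrite mul1n. Qed.

Lemma homRy_sum d (I : Type) (r : seq I) (F : I -> Ry) :
  (forall i, homRy d (F i)) -> homRy d (\sum_(i <- r) F i).
Proof. by move=> hF; elim/big_ind: _ => //; [exact: homRy0 | exact: homRyD]. Qed.

(** The powers y^i with i < l form a homogeneous R-basis of R_y; direct sums concatenate
    coordinates. *)
Lemma kmod_graded_coords s n (e : bool) :
  graded_coords wt (restr_gmod iota (GMod (@khom Ry homRy s n e))).
Proof.
elim: n e => [|n IH] e.
  exists 'I_l, (fun i : 'I_l => (i * dy)%:Z + (if e then s 0%N else 0)),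
    (fun (x : Ry) (i : 'I_l) => (rep x)`_i); split.
  - by move=> c x y i; rewrite -coefZ -coefD -repZ.
  - move=> x y h; apply: rep_inj; apply/polyP => j.
    have [hj|hj] := ltnP j l; first exact: (h (Ordinal hj)).
    by rewrite !nth_default // (leq_trans (size_rep _)).
  - move=> u; exists (pR (\poly_(j < l) if insub j is Some i then u i else 0)) => i.
    by rewrite rep_pR ?size_poly // coef_poly ltn_ord valK.
  - move=> d x; split=> [/homRyE hx i|hx].
      by rewrite opprD addrA addrAC; apply: hx.
    apply/homRyE => j; have [hj|hj] := ltnP j l.
      by rewrite addrAC -addrA -opprD; apply: (hx (Ordinal hj)).
    by rewrite nth_default ?(leq_trans (size_rep _)) //; apply: homR0.
case: (IH e) (IH (~~ e)) => [I [deg [K [Klin Kinj Ksurj Khom]]]].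
case=> [I' [deg' [K' [Klin' Kinj' Ksurj' Khom']]]].
exists (I + I')%type,
  (fun i => match i with inl i => deg i | inr i => deg' i + s n.+1 end),
  (fun (x : kmod Ry n * kmod Ry n) i =>
     match i with inl i => K x.1 i | inr i => K' x.2 i end); split.
- by move=> c x y [i|i]; [apply: Klin | apply: Klin'].
- case=> x1 x2 [y1 y2] h; congr pair.
    by apply: Kinj => i; apply: (h (inl i)).
  by apply: Kinj' => i; apply: (h (inr i)).
- move=> u; case: (Ksurj (fun i => u (inl i))) => x1 hx1.
  case: (Ksurj' (fun i => u (inr i))) => x2 hx2.
  by exists (x1, x2) => -[i|i]; [apply: hx1 | apply: hx2].
- move=> d x; split=> [[/Khom h1 /Khom' h2] [i|i]|h].
  + exact: h1.
  + by rewrite opprD addrCA addrC; apply: h2.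
  split; first by apply/Khom => i; apply: (h (inl i)).
  apply/Khom' => i; have := h (inr i).
  by rewrite opprD addrCA addrC.
Qed.

(** Freeness and the potential are carried over from the model; [a] and [b] need not be the entries
    that define [M]. *)
Lemma is_mf_restr (M : mf_data Ry) w s a b n :
  mf_iso M (kmodel homRy s a b n) ->
  (exists d, homR d w) -> iota w = \sum_(i < n.+1) a i * b i ->
  is_mf homR w (restr_mf iota M).
Proof.
move=> [f0 [f1 [g0 [g1 [[hf0 hf1 cf0 cf1] [hg0 hg1 _ _]]]]]].
case=> [fK0 gK0] [fK1 gK1] hw wE; split=> //.
- apply: graded_coords_free; apply: (@graded_coords_iso _ wt
    (restr_gmod iota (mf0 M)) (restr_gmod iota (GMod (@khom Ry homRy s n false)))
    f0 g0) => //; last exact: kmod_graded_coords.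
  by move=> c x y; apply: linearP.
- apply: graded_coords_free; apply: (@graded_coords_iso _ wt
    (restr_gmod iota (mf1 M)) (restr_gmod iota (GMod (@khom Ry homRy s n true)))
    f1 g1) => //; last exact: kmod_graded_coords.
  by move=> c x y; apply: linearP.
- move=> x; apply: (can_inj fK0); rewrite [LHS]cf1 /= [X in kdiff _ _ _ X]cf0.
  rewrite /= (kdiffK a b false) -wE.
  by rewrite -linearZ_LR.
- move=> x; apply: (can_inj fK1); rewrite [LHS]cf0 /= [X in kdiff _ _ _ X]cf1.
  rewrite /= (kdiffK a b true) -wE.
  by rewrite -linearZ_LR.
Qed.

Lemma mf_iso_restr (M N : mf_data Ry) :
  mf_iso M N -> mf_iso (restr_mf iota M) (restr_mf iota N).
Proof.
case=> [f0 [f1 [g0 [g1 [[? ? ? ?] [? ? ? ?] [? ?] [? ?]]]]]].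
by exists (restr_map iota f0), (restr_map iota f1), (restr_map iota g0),
  (restr_map iota g1).
Qed.

End QuotientRing.

(** * Syzygies *)

Section Syzygies.
Variables (k : nat) (wt : 'I_k -> nat).
Local Notation R := {mpoly rat[k]}.
Local Notation homR := (homR wt).

Definition weakly_regular (b : nat -> R) n := forall i x, (i < n)%N ->
  (exists c : nat -> R, b i * x = \sum_(j < i) c j * b j) ->
  exists c : nat -> R, x = \sum_(j < i) c j * b j.

Lemma regular_seq_weakly b n : regular_seq (mkseq b n) -> weakly_regular b n.
Proof.
case=> reg _ i x hi [c cE].
have tE : take i (mkseq b n) = mkseq b i.
  by rewrite /mkseq -map_take take_iota (minn_idPl (ltnW hi)).
have := reg i x; rewrite size_mkseq tE nth_mkseq // => /(_ hi).
case=> [|c' ->].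
  exists c; rewrite size_mkseq cE; apply: eq_bigr => j _.
  by rewrite nth_mkseq.
exists c'; rewrite size_mkseq; apply: eq_bigr => j _.
by rewrite nth_mkseq.
Qed.

(** Exactness of the Koszul complex in degree one. The relation puts [a n * b n] in the ideal of the
    earlier [b j], so regularity gives a_n = sum_j c_j b_j. Then the a_i + c_i b_n form a shorter
    syzygy, and its matrix is bordered by [c] and [- c]. *)
Lemma regular_syzygy n (b : nat -> R) (db : nat -> int) (d : int) (a : nat -> R) :
  weakly_regular b n ->
  (forall i, homR (db i) (b i)) -> (forall i, homR (d - db i) (a i)) ->
  \sum_(i < n) a i * b i = 0 ->
  exists T : nat -> nat -> R,
    [/\ forall i, T i i = 0, forall i j, T i j = - T j i,
        forall i j, homR (d - db i - db j) (T i j)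
      & forall i, (i < n)%N -> a i = \sum_(j < n) T i j * b j].
Proof.
move=> + hb; elim: n a => [|n IH] a reg ha.
  exists (fun _ _ => 0); split=> // i j; [by rewrite oppr0|exact: homR0].
rewrite big_ord_recr /= => hs.
have [c' c'E] : exists c : nat -> R, a n = \sum_(j < n) c j * b j.
  apply: (reg n (a n) (ltnSn n)); exists (fun j => - a j); apply/eqP.
  by under eq_bigr do rewrite mulNr; rewrite sumrN -addr_eq0 addrC mulrC hs.
(* Regularity gives no control of degrees; as [a n] is homogeneous, components of the [c' j]
   suffice. *)
pose c j := hproj wt (d - db n - db j) (c' j).
have hc j : homR (d - db n - db j) (c j) by apply: homR_hproj.
have cE : a n = \sum_(j < n) c j * b j.
  rewrite -(hproj_id (ha n)) c'E linear_sum /=; apply: eq_bigr => j _.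
  by rewrite -(hprojM _ _ (hb j)) subrK.
have reg' : weakly_regular b n by move=> i x hi; apply: reg; apply: ltnW.
have ha' i : homR (d - db i) (a i + c i * b n).
  apply: homRD => //; have -> : d - db i = (d - db n - db i) + db n by ring.
  exact: homRM.
case: (IH _ reg' ha').
  apply: etrans hs; rewrite cE mulr_suml -big_split; apply: eq_bigr => i _ /=.
  by rewrite mulrDl mulrAC.
move=> T [T0 TN hT TE].
exists (fun i j => if i == n then (if j == n then 0 else c j)
                   else if j == n then - c i else T i j); split.
- by move=> i; case: eqVneq.
- move=> i j; have [hi|hi] := eqVneq i n; have [hj|hj] := eqVneq j n => //=.
  + by rewrite oppr0.
  + by rewrite opprK.
- move=> i j; have [->|hi] := eqVneq i n; have [->|hj] := eqVneq j n => //=.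
  + exact: homR0.
  + by rewrite addrAC; apply: homRN.
- move=> i; rewrite ltnS leq_eqVlt => /orP[/eqP ->|hi].
    rewrite eqxx big_ord_recr /= eqxx mul0r addr0 cE.
    by apply: eq_bigr => j _; rewrite ltn_eqF.
  rewrite (ltn_eqF hi) big_ord_recr /= eqxx.
  under eq_bigr => j _ do rewrite (ltn_eqF (ltn_ord j)).
  by rewrite -TE // mulNr addrK.
Qed.

End Syzygies.

(** * Syzygies over the quotient ring and the resulting change of rows *)

Section QuotientSyzygies.
Variables (k : nat) (wt : 'I_k -> nat).
Local Notation R := {mpoly rat[k]}.
Variables (l : nat) (alpha : 'I_l -> R) (dy : nat).
Local Notation homR := (homR wt).
Local Notation homRX := (homRX wt dy).
Local Notation homRy := (@Defs.homRy k l alpha wt dy).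
Local Notation yrel := (yrel alpha).
Local Notation Ry := (Ry alpha).
Local Notation iota := (RtoRy alpha).
Implicit Types (P Q : {poly R}) (x y : Ry) (d : int) (c : R).
Hypothesis l_gt0 : (0 < l)%N.
Hypothesis yrel_homog : homRX (l * dy)%:Z yrel.

Lemma rep_sum (I : Type) (r : seq I) (F : I -> Ry) :
  rep (\sum_(i <- r) F i) = \sum_(i <- r) rep (F i).
Proof. by rewrite (big_morph (@rep _ _ alpha) (@repD _ _ alpha) (erefl _)). Qed.

Lemma coef_rep_sum n (A : nat -> Ry) (b : nat -> R) j :
  (rep (\sum_(i < n) A i * iota (b i)))`_j = \sum_(i < n) (rep (A i))`_j * b i.
Proof.
rewrite rep_sum coef_sum; apply: eq_bigr => i _.
by rewrite mulrC repZ // coefZ mulrC.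
Qed.

(** As the [b i] lie in R, each coefficient of y^j with j < l gives a syzygy over R; the matrices
    found for the various j are the coefficients of [T]. *)
Lemma quotient_syzygy n (b : nat -> R) (db : nat -> int) d (A : nat -> Ry) :
  weakly_regular b n ->
  (forall i, homR (db i) (b i)) -> (forall i, homRy (d - db i) (A i)) ->
  \sum_(i < n) A i * iota (b i) = 0 ->
  exists T : nat -> nat -> Ry,
    [/\ forall i, T i i = 0, forall i j, T i j = - T j i,
        forall i j, homRy (d - db i - db j) (T i j)
      & forall i, (i < n)%N -> A i = \sum_(j < n) T i j * iota (b j)].
Proof.
move=> reg hb hA hs.
have /fin_all_exists [T hT] : forall j : 'I_l, exists T : nat -> nat -> R,
    [/\ forall i, T i i = 0, forall i i', T i i' = - T i' i,
        forall i i', homR (d - (j * dy)%:Z - db i - db i') (T i i')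
      & forall i, (i < n)%N -> (rep (A i))`_j = \sum_(i' < n) T i i' * b i'].
  move=> j; apply: (@regular_syzygy _ _ n b db _ (fun i => (rep (A i))`_j)) => //.
    move=> i; rewrite addrAC; have /homRyE := hA i; apply => //.
  by rewrite -coef_rep_sum hs coef0.
pose P i i' := \poly_(j < l) (if insub j is Some j' then T j' i i' else 0).
have PE i i' (j : 'I_l) : (P i i')`_j = T j i i'.
  by rewrite coef_poly ltn_ord valK.
have P_big i i' j : (l <= j)%N -> (P i i')`_j = 0.
  by move=> hj; rewrite coef_poly ltnNge hj.
have eqP_l (Q Q' : {poly R}) : (forall j, (l <= j)%N -> Q`_j = 0) ->
   (forall j, (l <= j)%N -> Q'`_j = 0) -> (forall j : 'I_l, Q`_j = Q'`_j) -> Q = Q'.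
  move=> hQ hQ' h; apply/polyP => j; have [hj|hj] := ltnP j l.
    exact: (h (Ordinal hj)).
  by rewrite hQ ?hQ'.
exists (fun i i' => pR alpha (P i i')); split.
- move=> i; rewrite -[RHS](rmorph0 (pR alpha)); congr pR.
  apply: eqP_l => [j|j|j]; rewrite ?coef0 //; first exact: P_big.
  by rewrite PE; case: (hT j) => ->.
- move=> i i'; rewrite -rmorphN; congr pR.
  apply: eqP_l => [j hj|j hj|j]; rewrite ?coefN;
    [exact: P_big | by rewrite P_big ?oppr0|].
  by rewrite !PE; case: (hT j) => _ ->.
- move=> i i'; apply: homRy_pR => j; have [hj|hj] := ltnP j l.
    rewrite (PE i i' (Ordinal hj)); case: (hT (Ordinal hj)) => _ _ h _.
    have := h i i'; congr Defs.homR => /=; ring.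
  by rewrite P_big //; apply: homR0.
- move=> i hi; apply: rep_inj => //.
  apply: eqP_l => [j hj|j hj|j].
  + by rewrite nth_default // (leq_trans (size_rep _ _)).
  + by rewrite nth_default // (leq_trans (size_rep _ _)).
  rewrite (coef_rep_sum _ (fun i' => pR alpha (P i i'))).
  case: (hT j) => _ _ _ ->//; apply: eq_bigr => i' _.
  by rewrite rep_pR ?size_poly // PE.
Qed.

(** The degree condition on [T] is that of [kmodel_antisym]: as [da i + db i = D] and the
    differences are even, [D - db i - db j] equals [- s i - s j]. *)
Lemma koszul_change_rows n (D : int) (da db : nat -> int) (a a' b : nat -> Ry)
    (T : nat -> nat -> Ry) (w : R) :
  (forall i, da i + db i = D) -> (forall i, (2 %| db i - da i)%Z) ->
  (forall i, T i i = 0) -> (forall i j, T i j = - T j i) ->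
  (forall i j, (i <= n)%N -> (j <= n)%N -> homRy (D - db i - db j) (T i j)) ->
  (forall i, (i <= n)%N -> a' i = a i + \sum_(j < n.+1) T i j * b j) ->
  homR D w -> iota w = \sum_(i < n.+1) a i * b i ->
  mf_isomorphic homR w
    (restr_mf iota (koszul homRy (KRow (da 0) (db 0) (a 0) (b 0))
       [seq KRow (da i.+1) (db i.+1) (a i.+1) (b i.+1) | i <- seq.iota 0 n]))
    (restr_mf iota (koszul homRy (KRow (da 0) (db 0) (a' 0) (b 0))
       [seq KRow (da i.+1) (db i.+1) (a' i.+1) (b i.+1) | i <- seq.iota 0 n])).
Proof.
move=> hD h2 T0 TN hT a'E hw wE.
pose s i := ((db i - da i) %/ 2)%Z.
have hB d x y : homRy d x -> homRy d y -> homRy d (x - y) by apply: homRyB.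
have hM d (c : int) x y : homRy d x -> homRy c y -> homRy (d + c) (x * y).
  exact: homRyM.
have h0 d : homRy d 0 by apply: homRy0.
have h1 : homRy 0 1 by apply: homRy1.
have i1 := @koszul_kmodel _ _ h0 hB h1 hM s
  (fun i => KRow (da i) (db i) (a i) (b i)) n (fun i => erefl _).
have i2 := @koszul_kmodel _ _ h0 hB h1 hM s
  (fun i => KRow (da i) (db i) (a' i) (b i)) n (fun i => erefl _).
(* Composed with [i2], this presents the second factorization by the old entries, whose potential is
   known to be [w]. *)
have i3 : mf_iso (kmodel homRy s a' b n) (kmodel homRy s a b n).
  apply: mf_iso_sym; apply: mf_iso_trans (eq_kmodel _ _ _ _) => [|i hi]; last first.
    exact/esym/a'E.
  apply: kmodel_antisym => // i j hi hj.
  have := hT i j hi hj; congr Defs.homRy; rewrite /s.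
  by have := h2 i; have := h2 j; have := hD i; have := hD j; lia.
have i4 := mf_iso_trans i2 i3.
split.
- by apply: is_mf_restr i1 _ _ => //; exists D.
- by apply: is_mf_restr i4 _ _ => //; exists D.
exact: mf_iso_restr (mf_iso_trans i1 (mf_iso_sym i4)).
Qed.

End QuotientSyzygies.

(** * Choice of the new entries *)

Section ExtendFamily.
Variables (n : nat) (U : Type).
Implicit Types (x : U) (f : 'I_n -> U).

(** The default beyond [n] is the first entry, so that what holds for all entries holds at every
    index ([prepend_ind2]). *)
Definition prepend x f (i : nat) : U :=
  if i is j.+1 then (if insub j is Some j' then f j' else x) else x.

Lemma prependS x f (i : 'I_n) : prepend x f i.+1 = f i.
Proof. by rewrite /prepend valK. Qed.

Lemma prepend_mkseq x f : mkseq (prepend x f) n.+1 = x :: [seq f i | i <- enum 'I_n].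
Proof.
rewrite /mkseq /=; congr cons; rewrite -[1%N]addn0 iotaDl -map_comp -val_enum_ord.
by rewrite -map_comp; apply: eq_map => i /=; apply: prependS.
Qed.

End ExtendFamily.

Lemma prepend_ind2 n (U V : Type) (Q : U -> V -> Prop) x f y g :
  Q x y -> (forall i : 'I_n, Q (f i) (g i)) ->
  forall i, Q (prepend x f i) (prepend y g i).
Proof. by move=> h0 h [|i] //=; case: insubP => [j _ _|_]. Qed.

Lemma leq_ord_ind n (Q : nat -> Prop) :
  Q 0%N -> (forall i : 'I_n, Q i.+1) -> forall i, (i <= n)%N -> Q i.
Proof. by move=> h0 h [|i] // hi; apply: (h (Ordinal hi)). Qed.

Lemma prepend_rows (S : comNzRingType) n (da0 db0 : int) (a0 b0 : S)
    (da db : 'I_n -> int) (a b : 'I_n -> S) :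
  [seq KRow (da i) (db i) (a i) (b i) | i <- enum 'I_n] =
  [seq KRow (prepend da0 da i.+1) (prepend db0 db i.+1)
            (prepend a0 a i.+1) (prepend b0 b i.+1) | i <- iota 0 n].
Proof.
by rewrite -val_enum_ord -map_comp; apply: eq_map => i /=; rewrite !valK.
Qed.

Lemma mul_sum_divided (S : comNzRingType) n (z u : S) (a q r c : 'I_n -> S) :
  (forall i, a i = r i + z * q i) ->
  z * (u + \sum_(i < n) q i * c i) =
  u * z + \sum_(i < n) a i * c i - \sum_(i < n) r i * c i.
Proof.
move=> aE; rewrite mulrDr mulr_sumr mulrC -addrA -sumrB; congr (_ + _).
by apply: eq_bigr => i _; rewrite aE mulrDl addrAC subrr add0r mulrA.
Qed.

(** * The two reductions *)

Section Corollary.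
Variables (k : nat) (wt : 'I_k -> nat).
Local Notation R := {mpoly rat[k]}.
Variables (l : nat) (alpha : 'I_l -> R) (dy : nat).
Local Notation homR := (homR wt).
Local Notation homRX := (homRX wt dy).
Local Notation homRy := (@Defs.homRy k l alpha wt dy).
Local Notation yrel := (yrel alpha).
Local Notation Ry := (Ry alpha).
Local Notation iota := (RtoRy alpha).
Local Notation y := (yvar alpha).
Hypothesis l_gt0 : (0 < l)%N.
Hypothesis yrel_homog : homRX (l * dy)%:Z yrel.

Let iotaE d c : homRy d (iota c) <-> homR d c.
Proof. exact: homRy_iota. Qed.

Lemma koszul_reduce_a n (D da1 db1 : int) (da db : 'I_n -> int)
    (a1 b1 beta : Ry) (a : 'I_n -> Ry) (b : 'I_n -> R) (c1 w : R) :
  homRy dy%:Z beta ->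
  homRy da1 a1 -> homRy db1 b1 ->
  (forall i, homRy (da i) (a i)) -> (forall i, homR (db i) (b i)) ->
  (dy%:Z + da1) + db1 = D -> (forall i, da i + db i = D) ->
  (2 %| db1 - (dy%:Z + da1))%Z -> (forall i, (2 %| db i - da i)%Z) ->
  (y + beta) * b1 = iota c1 ->
  regular_seq (c1 :: [seq b i | i <- enum 'I_n]) ->
  iota w = a1 * b1 * (y + beta) + \sum_(i < n) a i * iota (b i) ->
  exists (a1' : R) (a' : 'I_n -> R),
    [/\ homR da1 a1', (forall i, homR (da i) (a' i)) &
      mf_isomorphic homR w
        (restr_mf iota (koszul homRy
           (KRow (dy%:Z + da1) db1 ((y + beta) * a1) b1)
           [seq KRow (da i) (db i) (a i) (iota (b i)) | i <- enum 'I_n]))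
        (restr_mf iota (koszul homRy
           (KRow (dy%:Z + da1) db1 ((y + beta) * iota a1') b1)
           [seq KRow (da i) (db i) (iota (a' i)) (iota (b i))
           | i <- enum 'I_n]))].
Proof.
move=> hbeta ha1 hb1 ha hb hD1 hD par1 par c1E reg wE.
set z := y + beta in c1E wE *.
have hz : homRy dy z by apply: homRyD => //; apply: homRy_yvar.
have hc1 : homR (dy%:Z + db1) c1.
  by apply/iotaE; rewrite -c1E; apply: homRyM.
pose red (x : Ry) : R := (rep x)`_0.
have hred d x : homRy d x -> homR d (red x).
  by move=> /homRyE /(_ 0%N); rewrite mul0n subr0; apply.
exists (red a1), (fun i => red (a i)); split=> [|i|]; try exact: hred.
pose A := prepend a1 a; pose C := prepend c1 b.
pose dC := prepend (dy%:Z + db1) db.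
have hA i : homRy (D - dC i) (A i).
  apply: (prepend_ind2 (Q := fun d x => homRy (D - d) x)) => [|{}i].
    by have -> : D - (dy%:Z + db1) = da1 by rewrite -hD1; ring.
  by rewrite -(hD i) addrK.
have hC i : homR (dC i) (C i) by apply: prepend_ind2.
have wAC : iota w = \sum_(i < n.+1) A i * iota (C i).
  rewrite wE big_ord_recl -mulrA [b1 * z]mulrC c1E.
  rewrite -[A ord0]/a1 -[C ord0]/c1; apply: (congr1 (+%R _)).
  by apply: eq_bigr => i _; rewrite [A _]prependS [C _]prependS.
have hw : homR D w.
  apply/iotaE; rewrite wAC; apply: homRy_sum => // i.
  by rewrite -[D](subrK (dC i)); apply: homRyM => //; apply/iotaE.
(* [red] is R-linear and returns [w] on [iota w], so the constant coefficients satisfy the same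
   relation as the [A i]. *)
have syz : \sum_(i < n.+1) (iota (red (A i)) - A i) * iota (C i) = 0.
  under eq_bigr do rewrite mulrBl -rmorphM.
  rewrite sumrB -wAC -rmorph_sum; apply/eqP; rewrite subr_eq0; apply/eqP.
  have := congr1 red wAC; rewrite /red coef_rep_sum // rep_iota coefC /= => ->.
  by [].
have reg' : weakly_regular C n.+1.
  by apply: regular_seq_weakly; rewrite prepend_mkseq.
have hB i : homRy (D - dC i) (iota (red (A i)) - A i).
  by apply: homRyB => //; apply/iotaE; apply: hred.
have [T [T0 TN hT TE]] := quotient_syzygy l_gt0 yrel_homog reg' hC hB syz.
(* [T] is a matrix for (c1, b), whereas the rows use b1 with c1 = z b1. Column 0 absorbs this
   factor, and row 0 needs it because the first entry is z a1. The entry (0, 0) vanishes, so the two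
   uses do not collide. *)
pose T' i j := if (i == 0%N) || (j == 0%N) then z * T i j else T i j.
have dCE i : (i <= n)%N ->
    dC i = (if i == 0%N then dy%:Z else 0) + prepend db1 db i.
  by move: i; apply: leq_ord_ind => [//|i]; rewrite /dC !prependS add0r.
pose brow := prepend b1 (fun i => iota (b i)).
have browE j : (j <= n)%N -> j != 0%N -> brow j = iota (C j).
  by move: j; apply: leq_ord_ind => [//|i _]; rewrite /brow /C !prependS.
rewrite (prepend_rows (dy%:Z + da1) db1 (z * a1) b1).
rewrite (prepend_rows (dy%:Z + da1) db1 (z * iota (red a1)) b1).
apply: (@koszul_change_rows _ wt _ alpha dy l_gt0 yrel_homog n D
  (prepend (dy%:Z + da1) da) (prepend db1 db) (prepend (z * a1) a)
  (prepend (z * iota (red a1)) (fun i => iota (red (a i))))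
  brow T') => //.
- by apply: (prepend_ind2 (Q := fun d d' => d + d' = D)).
- by apply: (prepend_ind2 (Q := fun d d' => (2 %| d' - d)%Z)).
- by move=> i; rewrite /T' orbb T0 mulr0 if_same.
- by move=> i j; rewrite /T' orbC TN; case: ifP => // _; rewrite mulrN.
- move=> i j hi hj; rewrite /T'.
  have hzT := homRyM l_gt0 yrel_homog hz (hT i j).
  have [i0|i0] := eqVneq i 0%N; have [j0|j0] := eqVneq j 0%N; rewrite /=.
  + by rewrite i0 j0 T0 mulr0; apply: homRy0.
  + move: hzT; congr Defs.homRy.
    by rewrite dCE // dCE // i0 (negPf j0) /=; ring.
  + move: hzT; congr Defs.homRy.
    by rewrite dCE // dCE // j0 (negPf i0) /=; ring.
  + by have := hT i j; rewrite dCE // dCE // (negPf i0) (negPf j0) !add0r.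
- move=> i hi; move: i hi; apply: leq_ord_ind => [|i].
    have T'E j : (j <= n)%N -> T' 0%N j * brow j = z * (T 0%N j * iota (C j)).
      move=> hj; rewrite /T' /= -mulrA; have [->|j0] := eqVneq j 0%N.
        by rewrite T0 !mul0r.
      by rewrite browE.
    under eq_bigr => j _ do rewrite (T'E j (ltn_ord j)).
    rewrite -mulr_sumr -TE // -[prepend _ _ 0%N]/(z * iota (red a1)).
    by rewrite -[prepend _ _ 0%N]/(z * a1) mulrBr addrC subrK.
  have T'E j : (j <= n)%N -> T' i.+1 j * brow j = T i.+1 j * iota (C j).
    move=> hj; rewrite /T' /=; have [->|j0] := eqVneq j 0%N; last by rewrite browE.
    by rewrite -c1E -[brow 0%N]/b1 mulrCA mulrA.
  under eq_bigr => j _ do rewrite (T'E j (ltn_ord j)).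
  rewrite -TE ?ltnS ?ltn_ord // !prependS.
  by rewrite [A _]prependS addrC subrK.
- rewrite wE big_ord_recl -mulrA [b1 * z]mulrC [a1 * _]mulrCA mulrA.
  apply: (congr1 (+%R _)); apply: eq_bigr => i _.
  by rewrite /brow !prependS.
Qed.

(* Dividing the [a i] by [z = y + beta] leaves [z u] in [R], where               *)
(* [u = a1 b1 + sum_i q_i b_i] lifts to [U] of degree at most [l - 1] and [q_i]  *)
(* are the quotients.  With [e] the coefficient of [y^(l-1)] in [a1], comparing  *)
(* coefficients of ['X^l] shows that [('X + beta) U - b1 e yrel] is constant, so *)
(* [U] is [b1 e] times the quotient of [yrel] by ['X + beta].                    *)
Lemma split_syzygy n (da1 : int) (da : 'I_n -> int) (a1 : Ry) (a : 'I_n -> Ry)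
    (b1 beta w : R) (b : 'I_n -> R) (z : Ry) :
  z = y + iota beta -> homR dy%:Z beta -> homRy da1 a1 ->
  (forall i, homRy (da i) (a i)) ->
  iota w = a1 * iota b1 * z + \sum_(i < n) a i * iota (b i) ->
  exists (a1' : Ry) (r : 'I_n -> R) (q : 'I_n -> Ry),
    [/\ homRy da1 a1', forall i, homR (da i) (r i),
        forall i, homRy (da i - dy%:Z) (q i),
        forall i, a i = iota (r i) + z * q i
      & (a1 - a1') * iota b1 + \sum_(i < n) q i * iota (b i) = 0].
Proof.
move=> zE hbeta ha1 ha wE; set Z : {poly R} := 'X + beta%:P.
have pZ : pR alpha Z = z by rewrite zE pRD pRX pRC.
have Zbeta : Z.[- beta] = 0 by rewrite !hornerE addNr.
have div_rep i : exists Q : {poly R}, [/\ homRX (da i - dy%:Z) Q,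
    (size Q <= l.-1)%N, homR (da i) (rep (a i)).[- beta]
    & rep (a i) = Q * Z + ((rep (a i)).[- beta])%:P].
  have [Q [hQ sQ hr E]] := div_XaddC ((homRyE l_gt0 yrel_homog _ _).1 (ha i)) hbeta.
  exists Q; split=> //; apply: leq_trans sQ _.
  by rewrite -!subn1 leq_sub2r // size_rep.
case: (fin_all_exists div_rep) => Q hQ {div_rep}.
have [G [hG sG _ GE]] := div_XaddC yrel_homog hbeta.
pose e := (rep a1)`_l.-1.
have he : homR (da1 - (l.-1 * dy)%:Z) e by exact: (homRyE l_gt0 yrel_homog _ _).1 ha1 _.
pose r i := (rep (a i)).[- beta]; pose q i := pR alpha (Q i).
have aE i : a i = iota (r i) + z * q i.
  case: (hQ i) => _ _ _ E; rewrite -[LHS]repK // E pRD pRM pRC // pZ.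
  by rewrite addrC mulrC.
(* [G] is the quotient of [yrel] by X + beta; the degrees of [e] and [G] add up to [da1]. *)
exists (pR alpha (e *: G)), r, q; split=> //.
- apply: homRy_pR; have -> : da1 = (da1 - (l.-1 * dy)%:Z) + ((l * dy)%:Z - dy%:Z).
    by have := l_gt0; nia.
  exact: homRXZ.
- by move=> i; case: (hQ i).
- by move=> i; apply: homRy_pR; case: (hQ i).
pose U := b1 *: rep a1 + \sum_(i < n) b i *: Q i.
have sU : (size U <= l)%N.
  apply: leq_trans (size_polyD _ _) _; rewrite geq_max; apply/andP; split.
    exact: leq_trans (size_scale_leq _ _) (size_rep l_gt0 _).
  apply: leq_trans (size_sum _ _ _) _; apply/bigmax_leqP => i _.
  apply: leq_trans (size_scale_leq _ _) _.
  by case: (hQ i) => _ h _ _; apply: leq_trans h (leq_pred _).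
have pU : pR alpha U = a1 * iota b1 + \sum_(i < n) q i * iota (b i).
  rewrite pRD pR_sum pRZ // repK // mulrC.
  apply: (congr1 (+%R _)); apply: eq_bigr => i _.
  by rewrite pRZ // mulrC.
pose rho := w - \sum_(i < n) r i * b i.
have pZU : pR alpha (Z * U) = iota rho.
  have rbE : iota (\sum_(i < n) r i * b i) = \sum_(i < n) iota (r i) * iota (b i).
    by rewrite (rmorph_sum iota); apply: eq_bigr => i _; rewrite (rmorphM iota).
  rewrite pRM pU pZ (rmorphB iota) rbE wE.
  exact: (mul_sum_divided _ _ aE).
(* The quotients [Q i] have size at most l - 1, so only [rep a1] contributes to the top
   coefficient. *)
have Ul : U`_l.-1 = b1 * e.
  rewrite coefD coefZ coef_sum big1 ?addr0 // => i _.
  by rewrite coefZ nth_default ?mulr0 //; case: (hQ i).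
have yl : yrel`_l = 1.
  by have := yrel_monic alpha; rewrite monicE lead_coefE size_yrel => /eqP.
pose V := Z * U - (b1 * e) *: yrel.
have sV : (size V <= l)%N.
  apply/leq_sizeP => j hj; rewrite coefB coefZ /Z mulrDl coefD coefXM mul_polyC coefZ.
  have -> : U`_j = 0 by rewrite nth_default // (leq_trans sU).
  rewrite mulr0 addr0; have [->|hj'] := eqVneq j l.
    by rewrite (gtn_eqF l_gt0) Ul yl mulr1 subrr.
  rewrite [yrel`_j]nth_default ?size_yrel; last by rewrite ltn_neqAle eq_sym hj'.
  rewrite mulr0 subr0; case: ifP => // _; rewrite nth_default //.
  by apply: leq_trans sU _; move: hj hj'; lia.
(* [V] has size at most [l], hence is the reduced representative of its class, which is that of
   [rho]. *)
have VE : V = rho%:P.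
  rewrite -(rep_iota alpha) -pZU -[LHS](@rep_pR _ _ alpha l_gt0) //; congr rep.
  by rewrite /V pRB [pR _ (_ *: yrel)]pRZ // pR_yrel // mulr0 subr0.
have UE : U = (b1 * e) *: G.
  have Z0 : Z != 0 by rewrite -size_poly_eq0 size_XaddC.
  (* The left side vanishes at - beta and the right side is constant, so both are 0; R[X] being a
     domain, the second factor is 0. *)
  have E : Z * (U - (b1 * e) *: G) = (rho + b1 * e * yrel.[- beta])%:P.
    rewrite mulrBr -[Z * U](subrK ((b1 * e) *: yrel)) -/V VE {1}GE.
    rewrite -!mul_polyC (polyCD rho) !polyCM -/Z; ring.
  have := congr1 (fun P => P.[- beta]) E.
  rewrite hornerM Zbeta mul0r hornerC => E0; move: E; rewrite -E0 => /eqP.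
  by rewrite mulf_eq0 (negPf Z0) /= subr_eq0 => /eqP.
rewrite mulrBl addrAC -pU UE !pRZ // (rmorphM iota).
by rewrite [iota b1 * _]mulrC mulrAC subrr.
Qed.

Lemma koszul_reduce_b n (D da1 db1 : int) (da db : 'I_n -> int)
    (a1 : Ry) (a : 'I_n -> Ry) (b1 beta : R) (b : 'I_n -> R) (w : R) (z : Ry) :
  z = y + iota beta -> homR dy%:Z beta ->
  homRy da1 a1 -> homR db1 b1 ->
  (forall i, homRy (da i) (a i)) -> (forall i, homR (db i) (b i)) ->
  da1 + (db1 + dy%:Z) = D -> (forall i, da i + db i = D) ->
  (2 %| (db1 + dy%:Z) - da1)%Z -> (forall i, (2 %| db i - da i)%Z) ->
  regular_seq (b1 :: [seq b i | i <- enum 'I_n]) ->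
  iota w = a1 * iota b1 * z + \sum_(i < n) a i * iota (b i) ->
  exists (a1' : Ry) (a' : 'I_n -> R),
    [/\ homRy da1 a1', (forall i, homR (da i) (a' i)) &
      mf_isomorphic homR w
        (restr_mf iota (koszul homRy (KRow da1 (db1 + dy%:Z) a1 (iota b1 * z))
           [seq KRow (da i) (db i) (a i) (iota (b i)) | i <- enum 'I_n]))
        (restr_mf iota (koszul homRy (KRow da1 (db1 + dy%:Z) a1' (iota b1 * z))
           [seq KRow (da i) (db i) (iota (a' i)) (iota (b i))
           | i <- enum 'I_n]))].
Proof.
move=> zE hbeta ha1 hb1 ha hb hD1 hD par1 par reg wE.
have [a1' [r [q [ha1' hr hq aE syzE]]]] := split_syzygy zE hbeta ha1 ha wE.
exists a1', r; split=> //.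
have hz : homRy dy z.
  by rewrite zE; apply: homRyD => //; [apply: homRy_yvar | apply/iotaE].
have hw : homR D w.
  apply/iotaE; rewrite wE; apply: homRyD => //.
    rewrite -hD1 addrA; apply: homRyM => //; apply: homRyM => //; exact/iotaE.
  by apply: homRy_sum => // i; rewrite -(hD i); apply: homRyM => //; apply/iotaE.
pose B := prepend (a1' - a1) (fun i => - q i); pose C := prepend b1 b.
pose dC := prepend db1 db.
have hB i : homRy (D - dy%:Z - dC i) (B i).
  apply: (prepend_ind2 (Q := fun d x => homRy (D - dy%:Z - d) x)) => [|{}i].
    have -> : D - dy%:Z - db1 = da1 by rewrite -hD1; ring.
    exact: homRyB.
  have -> : D - dy%:Z - db i = da i - dy%:Z by rewrite -(hD i); ring.
  exact: homRyN.
have hC i : homR (dC i) (C i) by apply: prepend_ind2.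
have syz : \sum_(i < n.+1) B i * iota (C i) = 0.
  rewrite big_ord_recl -[B ord0]/(a1' - a1) -[C ord0]/b1.
  apply: oppr_inj; rewrite oppr0; apply: etrans syzE.
  rewrite opprD -mulNr opprB; apply: (congr1 (+%R _)); rewrite -sumrN.
  by apply: eq_bigr => i _; rewrite [B _]prependS [C _]prependS mulNr opprK.
have reg' : weakly_regular C n.+1.
  by apply: regular_seq_weakly; rewrite prepend_mkseq.
have [T [T0 TN hT TE]] := quotient_syzygy l_gt0 yrel_homog reg' hC hB syz.
(* Row 0 must change a1 by a1' - a1 exactly, while row i must change a_i by - z q_i. The factor z in
   column 0 is already supplied by the entry b1 z, so only the remaining block is multiplied by
   z. *)
pose T' i j := if (i == 0%N) || (j == 0%N) then T i j else z * T i j.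
pose db' := prepend (db1 + dy%:Z) db.
have dbE i : (i <= n)%N -> db' i = dC i + (if i == 0%N then dy%:Z else 0).
  by move: i; apply: leq_ord_ind => [//|i]; rewrite /dC /db' !prependS addr0.
pose brow := prepend (iota b1 * z) (fun i => iota (b i)).
have browE j : (j <= n)%N -> j != 0%N -> brow j = iota (C j).
  by move: j; apply: leq_ord_ind => [//|i _]; rewrite /brow /C !prependS.
rewrite (prepend_rows da1 (db1 + dy%:Z) a1 (iota b1 * z)).
rewrite (prepend_rows da1 (db1 + dy%:Z) a1' (iota b1 * z)).
apply: (@koszul_change_rows _ wt _ alpha dy l_gt0 yrel_homog n D
  (prepend da1 da) db' (prepend a1 a) (prepend a1' (fun i => iota (r i)))
  brow T') => //.
- by apply: (prepend_ind2 (Q := fun d d' => d + d' = D)).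
- by apply: (prepend_ind2 (Q := fun d d' => (2 %| d' - d)%Z)).
- by move=> i; rewrite /T' orbb T0 mulr0 if_same.
- by move=> i j; rewrite /T' orbC TN; case: ifP => // _; rewrite mulrN.
- move=> i j hi hj; rewrite /T' !dbE //.
  have hzT := homRyM l_gt0 yrel_homog hz (hT i j).
  have [i0|i0] := eqVneq i 0%N; have [j0|j0] := eqVneq j 0%N; rewrite /=.
  + by rewrite i0 j0 T0; apply: homRy0.
  + by have := hT i j; congr Defs.homRy; ring.
  + by have := hT i j; congr Defs.homRy; ring.
  + by move: hzT; congr Defs.homRy; ring.
- apply: leq_ord_ind => [|i].
    have T'E j : (j <= n)%N -> T' 0%N j * brow j = T 0%N j * iota (C j).
      move=> hj; rewrite /T' /=; have [->|j0] := eqVneq j 0%N.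
        by rewrite T0 !mul0r.
      by rewrite browE.
    under eq_bigr => j _ do rewrite (T'E j (ltn_ord j)).
    by rewrite -TE // addrC subrK.
  have T'E j : (j <= n)%N -> T' i.+1 j * brow j = z * (T i.+1 j * iota (C j)).
    move=> hj; rewrite /T' /=; have [->|j0] := eqVneq j 0%N.
      by rewrite -[brow 0%N]/(iota b1 * z) mulrA mulrC.
    by rewrite browE // mulrA.
  under eq_bigr => j _ do rewrite (T'E j (ltn_ord j)).
  rewrite -mulr_sumr -TE ?ltnS ?ltn_ord // !prependS.
  by rewrite [B _]prependS mulrN aE addrK.
- rewrite wE big_ord_recl -[a1 * iota b1 * z]mulrA.
  apply: (congr1 (+%R _)); apply: eq_bigr => i _.
  by rewrite /brow !prependS.
Qed.

End Corollary.

(* With m = n + 1, the first entries are a1, b1, of degrees da1, db1, and the *)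
(* entries a_(i+2), b_(i+2) are a i, b i with i : 'I_n; all the row degree    *)
(* sums are D, the degree of the potential.                                   *)
Theorem corollary2p11 (k : nat) (wt : 'I_k -> nat)
  (wt_gt0 : forall i, (0 < wt i)%N)
  (l : nat) (l_gt0 : (0 < l)%N) (alpha : 'I_l -> {mpoly rat[k]})
  (dy : nat) (dy_gt0 : (0 < dy)%N)
  (yrel_homog : homRX wt dy (l * dy)%:Z (yrel alpha)) :
  (forall (n : nat) (D da1 db1 : int) (da db : 'I_n -> int)
      (a1 b1 beta : Ry alpha) (a : 'I_n -> Ry alpha)
      (b : 'I_n -> {mpoly rat[k]}) (c1 w : {mpoly rat[k]}),
    homRy wt dy dy%:Z beta ->
    homRy wt dy da1 a1 -> homRy wt dy db1 b1 ->
    (forall i, homRy wt dy (da i) (a i)) ->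
    (forall i, homR wt (db i) (b i)) ->
    (dy%:Z + da1) + db1 = D -> (forall i, da i + db i = D) ->
    (2 %| db1 - (dy%:Z + da1))%Z -> (forall i, (2 %| db i - da i)%Z) ->
    (yvar alpha + beta) * b1 = RtoRy alpha c1 ->
    regular_seq (c1 :: [seq b i | i <- enum 'I_n]) ->
    RtoRy alpha w =
      a1 * b1 * (yvar alpha + beta) + \sum_(i < n) a i * RtoRy alpha (b i) ->
    exists (a1' : {mpoly rat[k]}) (a' : 'I_n -> {mpoly rat[k]}),
      [/\ homR wt da1 a1', (forall i, homR wt (da i) (a' i)) &
        mf_isomorphic (homR wt) w
          (restr_mf (RtoRy alpha) (koszul (homRy wt dy)
             (KRow (dy%:Z + da1) db1 ((yvar alpha + beta) * a1) b1)
             [seq KRow (da i) (db i) (a i) (RtoRy alpha (b i))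
             | i <- enum 'I_n]))
          (restr_mf (RtoRy alpha) (koszul (homRy wt dy)
             (KRow (dy%:Z + da1) db1
                ((yvar alpha + beta) * RtoRy alpha a1') b1)
             [seq KRow (da i) (db i) (RtoRy alpha (a' i)) (RtoRy alpha (b i))
             | i <- enum 'I_n]))])
  /\
  (forall (n : nat) (D da1 db1 : int) (da db : 'I_n -> int)
      (a1 : Ry alpha) (a : 'I_n -> Ry alpha)
      (b1 beta : {mpoly rat[k]}) (b : 'I_n -> {mpoly rat[k]})
      (w : {mpoly rat[k]}),
    homR wt dy%:Z beta ->
    homRy wt dy da1 a1 -> homR wt db1 b1 ->
    (forall i, homRy wt dy (da i) (a i)) ->
    (forall i, homR wt (db i) (b i)) ->
    da1 + (db1 + dy%:Z) = D -> (forall i, da i + db i = D) ->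
    (2 %| (db1 + dy%:Z) - da1)%Z -> (forall i, (2 %| db i - da i)%Z) ->
    regular_seq (b1 :: [seq b i | i <- enum 'I_n]) ->
    RtoRy alpha w =
      a1 * RtoRy alpha b1 * (yvar alpha + RtoRy alpha beta)
      + \sum_(i < n) a i * RtoRy alpha (b i) ->
    exists (a1' : Ry alpha) (a' : 'I_n -> {mpoly rat[k]}),
      [/\ homRy wt dy da1 a1', (forall i, homR wt (da i) (a' i)) &
        mf_isomorphic (homR wt) w
          (restr_mf (RtoRy alpha) (koszul (homRy wt dy)
             (KRow da1 (db1 + dy%:Z) a1
                (RtoRy alpha b1 * (yvar alpha + RtoRy alpha beta)))
             [seq KRow (da i) (db i) (a i) (RtoRy alpha (b i))
             | i <- enum 'I_n]))
          (restr_mf (RtoRy alpha) (koszul (homRy wt dy)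
             (KRow da1 (db1 + dy%:Z) a1'
                (RtoRy alpha b1 * (yvar alpha + RtoRy alpha beta)))
             [seq KRow (da i) (db i) (RtoRy alpha (a' i)) (RtoRy alpha (b i))
             | i <- enum 'I_n]))]).
Proof.
split.
  move=> n D da1 db1 da db a1 b1 beta a b c1 w.
  exact: (koszul_reduce_a l_gt0 yrel_homog).
move=> n D da1 db1 da db a1 a b1 beta b w.
exact: (koszul_reduce_b l_gt0 yrel_homog erefl).
Qed.
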